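(* Let $\mathbf{y}=(y_1,\dots,y_n)^{\intercal}$ be independent samples from a density $f_\theta$ with scalar fixed unknown $\theta\in\Theta$, let $U=Y_{n+1}$ be a future random unknown from the density $f_\theta(u)$ with support $\Omega_u$, and let $T=T(\mathbf{Y})$, with observed value $t=T(\mathbf{y})\in\Omega$, be a sufficient statistic for $\theta$. Suppose there exists a monotone one-to-one transformation $\eta=\eta(\theta)$ from the parameter space $\Theta$ to $\Omega$ such that, for any $t\in\Omega$, $$F_n(t;\eta)=F_n(\eta;t),$$ where $F_n(\cdot\,;\eta)$ is the cumulative distribution function of $T$ with parameter $\eta$ and sample size $n$. Let $c(\theta;\mathbf{y})=|\nabla_\theta P_\theta(T\geq t)|$ and let $$c(u;\mathbf{y})=c(u;t)=\int_{\Theta}c(\theta;\mathbf{y})\,f_\theta(u|\mathbf{y})\,d\theta .$$ Let $\mathrm{CI}_\alpha(t)\subseteq\Theta$ and $\mathrm{PI}_\alpha(t)\subseteq\Omega_u$ be observed intervals of $\theta$ and $u$ such that $$\int_{\mathrm{CI}_\alpha(t)}c(\theta;\mathbf{y})\,d\theta=1-\alpha\quad\text{and}\quad\int_{\mathrm{PI}_\alpha(t)}c(u;\mathbf{y})\,du=1-\alpha .$$ Let $q_\alpha(t)$ be the $\alpha$-quantile of $c(u;t)$. If $F_1(q_\alpha(t);\eta)=F_1(t;q_\alpha(\eta))$, where $F_1(\cdot\,;\eta)$ is the cumulative distribution function of the sufficient statistic for the future value $U=Y_{n+1}$, then for any true $\theta_0\in\Theta$, $$P_{\theta_0}(\theta_0\in\mathrm{CI}_\alpha(T))=1-\alpha\quad\text{and}\quad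 P_{\theta_0}(U\in\mathrm{PI}_\alpha(T))=1-\alpha .$$
   Context: $P_\theta$ denotes probability under parameter $\theta$; $P_{\theta_0}(U\in\mathrm{PI}_\alpha(T))$ is the marginal coverage probability, taken over the joint law of $(T,U)$. $F_n(\eta;t)$ denotes the same function with the roles of argument and parameter exchanged, and the identity involving $q_\alpha$ is understood for $t,\eta\in\Omega$. The densities arise from the h-confidence (a modified extended likelihood) $$c_h(\theta,u;\mathbf{y})=c(\theta;\mathbf{y})f_\theta(u|\mathbf{y})=c_0(\theta;\mathbf{y})L_e(\theta,u;\mathbf{y}),$$ where $L_e(\theta,u;\mathbf{y})=f_\theta(\mathbf{y},u)$ is the extended likelihood and $c_0(\theta;\mathbf{y})=c(\theta;\mathbf{y})/L(\theta;\mathbf{y})$ with $L(\theta;\mathbf{y})=f_\theta(\mathbf{y})$. Its marginals are the confidence density $c(\theta;\mathbf{y})$ for $\theta$ and the predictive density $c(u;\mathbf{y})$ for $u$.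
   Formalization: Added: the mass left of CI and PI is the same for all data (else false); the q-identity holds at every level, with q on the scale of a strictly monotone sufficient statistic of U valued in Ω; Ω_u is an interval; Θ is open; P_θ(T≥t) is differentiable, c(θ;y) has mass 1; measurability. *)

(* Defs.v *)
Set Warnings "-notation-overridden,-ambiguous-paths".
From HB Require Import structures.
From mathcomp Require Export all_boot all_order all_algebra.
From mathcomp Require Export all_classical all_reals all_analysis.
Export Order.TTheory GRing.Theory Num.Theory.
Export numFieldNormedType.Exports.

Set Implicit Arguments.
Unset Strict Implicit.
Unset Printing Implicit Defensive.

Local Open Scope classical_set_scope.
Local Open Scope ring_scope.

Definition monotone_on (R : realType) (A : set R) (g : R -> R) : Prop :=
  {in A &, {homo g : x y / x <= y}} \/ {in A &, {homo g : x y /~ x <= y}}.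

Definition mutually_independent d (W : measurableType d) (R : realType)
    (P : probability W R) (I : finType) (X : I -> {mfun W >-> R}) : Prop :=
  forall (J : {set I}) (A : I -> set R),
    (forall i, i \in J -> measurable (A i)) ->
    P (\bigcap_(i in [set` J]) (X i @^-1` A i)) =
    (\prod_(i in J) P (X i @^-1` A i))%E.

(* The law of Z has Lebesgue density g, which is positive exactly on D. *)
Definition has_density_on d (W : measurableType d) (R : realType)
    (P : probability W R) (Z : {mfun W >-> R}) (g : R -> R) (D : set R) : Prop :=
  [/\ forall u, 0 <= g u,
      forall u, 0 < g u <-> D u
    & forall A, measurable A ->
        P (Z @^-1` A) = (\int[@lebesgue_measure R]_(u in A) (g u)%:E)%E].

(* kappa is a version, common to all theta in Theta, of the conditional law of
   the data Z given S(Z). *)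
Definition sufficient d (W : measurableType d) (R : realType) (Theta : set R)
    (P : R -> probability W R) d' (E : measurableType d')
    (Z : {mfun W >-> E}) (S : {mfun E >-> R}) : Prop :=
  exists kappa : R.-pker R ~> E,
    forall (theta : R) (A : set E) (B : set R), Theta theta ->
      measurable A -> measurable B ->
      P theta (Z @^-1` A `&` Z @^-1` (S @^-1` B)) =
      (\int[P theta]_(w in Z @^-1` (S @^-1` B)) kappa (S (Z w)) A)%E.

(* X_0, ..., X_(n-1) are the observed sample; X_n, the last coordinate, is the
   future value. *)
Definition sample d (W : measurableType d) (R : realType) (n : nat)
    (X : 'I_n.+1 -> {mfun W >-> R}) (w : W) : n.-tuple R :=
  [tuple X (widen_ord (leqnSn n) i) w | i < n].

Lemma measurable_sample d (W : measurableType d) (R : realType) (n : nat)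
  (X : 'I_n.+1 -> {mfun W >-> R}) : measurable_fun [set: W] (sample X).
Proof.
apply/measurable_fun_tnthP => i.
rewrite (_ : _ \o _ = X (widen_ord (leqnSn n) i)) //.
by apply/funext => w /=; rewrite tnth_mktuple.
Qed.

HB.instance Definition _ d (W : measurableType d) (R : realType) (n : nat)
    (X : 'I_n.+1 -> {mfun W >-> R}) :=
  isMeasurableFun.Build _ _ W (n.-tuple R) (sample X) (measurable_sample X).

Definition sample_space (R : realType) (n : nat) (D : set R) : set (n.-tuple R) :=
  [set y | forall i, D (tnth y i)].

(* F(x; h): distribution function of Z when the parameter theta is the one with
   eta(theta) = h; only meaningful for h in the range of eta on Theta. *)
Definition cdf_eta d (W : measurableType d) (R : realType) (Theta : set R)
    (P : R -> probability W R) (eta : R -> R) (Z : {mfun W >-> R})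
    (x h : R) : \bar R :=
  cdf (Z : {RV P (pinv Theta eta h) >-> R}) x.

Definition tail_prob d (W : measurableType d) (R : realType)
    (P : R -> probability W R) (Z : {mfun W >-> R}) (t theta : R) : R :=
  fine (P theta [set w | t <= Z w]).

(* c(theta; y) depends on the data y only through t = T(y); Z is T(Y). *)
Definition conf_density d (W : measurableType d) (R : realType)
    (P : R -> probability W R) (Z : {mfun W >-> R}) (t theta : R) : R :=
  `| derive1 (tail_prob P Z t) theta |.

(* L(theta; y) and L_e(theta, u; y): joint densities of the sample, and of the
   sample together with the future value, all coordinates being independent. *)
Definition lik (R : realType) (n : nat) (f : R -> R -> R)
    (y : n.-tuple R) (theta : R) : R :=
  \prod_(i < n) f theta (tnth y i).

Definition ext_lik (R : realType) (n : nat) (f : R -> R -> R)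
    (y : n.-tuple R) (theta u : R) : R :=
  lik f y theta * f theta u.

(* f_theta(u | y); it equals f_theta(u) when y lies in the support. *)
Definition cond_density (R : realType) (n : nat) (f : R -> R -> R)
    (y : n.-tuple R) (theta u : R) : R :=
  ext_lik f y theta u / lik f y theta.

Definition h_confidence d (W : measurableType d) (R : realType) (n : nat)
    (P : R -> probability W R) (Z : {mfun W >-> R}) (T : n.-tuple R -> R)
    (f : R -> R -> R) (y : n.-tuple R) (theta u : R) : R :=
  conf_density P Z (T y) theta * cond_density f y theta u.

(* c(u; y), the u-marginal of the h-confidence; it depends on y only through
   T(y), which is how it is also written c(u; t). *)
Definition pred_density d (W : measurableType d) (R : realType) (n : nat)
    (Theta : set R) (P : R -> probability W R) (Z : {mfun W >-> R})
    (T : n.-tuple R -> R) (f : R -> R -> R) (y : n.-tuple R) (u : R) : \bar R :=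
  (\int[@lebesgue_measure R]_(theta in Theta)
     (h_confidence P Z T f y theta u)%:E)%E.

(* The a-quantile of a density c on the line, for 0 < a < 1. *)
Definition quantile (R : realType) (c : R -> \bar R) (a : R) : R :=
  inf [set x | (a%:E <= \int[@lebesgue_measure R]_(u in `]-oo, x]) c u)%E].

Definition left_of (R : realType) (I : set R) : set R :=
  [set x | forall z, I z -> x < z].

(* Main.v *)
From HB Require Import structures.
Require Import Defs.
From mathcomp Require Import measurable_realfun ring lra.
Set Implicit Arguments.
Unset Strict Implicit.
Unset Printing Implicit Defensive.
Local Open Scope classical_set_scope.
Local Open Scope ring_scope.

(* Write [F(t; h)] for the distribution function of [T] at [eta theta = h].
   Symmetry and the differentiability of the tail probabilities force [T] to be
   atomless, so that the tail probability [P_theta(T >= t)] is [1 - F(eta theta; t)]: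
   as a function of [theta] it is monotone, and it is governed by the law of [T]
   under the parameter [eta^-1 t].  By Fatou the integral of the derivative of a
   monotone function is at most its variation; as the confidence density has mass
   [1], equality holds on every half-line, so the confidence mass to the left of
   [theta0] is [F(T; eta theta0)] or its complement, which is uniform under
   [theta0]: this is the coverage of [CI].

   For the prediction, the [a]-quantile [q a t] takes every value in the interior
   of the support as [a] varies, so [F1(q a t; h) = F1(t; q a h)] at [t = h] gives
   [F1(x; t) = F1(t; x)].  With [h = eta theta0] the confidence density at [h] is
   the law of [eta^-1 T] under [theta0], whence, for [T1] increasing,
   [a = E F1(q a h; T) = E F1(T; q a h) = E F1(q a T; h) = P_theta0(U <= q a T)],
   the last step because [U] is independent of [T].  So the predictive mass to
   the left of [U] is again uniform. *)

(** * Tonelli on rectangles and measurable comparisons *)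

Section fubini_in.
Context d1 d2 (T1 : measurableType d1) (T2 : measurableType d2) (R : realType).
Variables (m1 : {sigma_finite_measure set T1 -> \bar R})
  (m2 : {sigma_finite_measure set T2 -> \bar R}).
Variables (A : set T1) (B : set T2) (f : T1 * T2 -> \bar R).
Hypotheses (mA : measurable A) (mB : measurable B).
Hypotheses (mf : measurable_fun (A `*` B : set (T1 * T2)) f)
  (f0 : forall p, (A `*` B) p -> (0 <= f p)%E).

Let mAB : measurable (A `*` B). Proof. exact: measurableX. Qed.

Let mfr : measurable_fun setT (f \_ (A `*` B)).
Proof. by apply/(measurable_restrictT f mAB). Qed.

Let fr0 p : (0 <= (f \_ (A `*` B)) p)%E.
Proof. by apply: erestrict_ge0 => q /f0. Qed.

Let restrictF x : A x ->
  (\int[m2]_(y in B) f (x, y) = \int[m2]_y (f \_ (A `*` B)) (x, y))%E.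
Proof.
move=> Ax; rewrite integral_mkcond; apply: eq_integral => y _.
by rewrite !patchE in_setX (mem_set Ax).
Qed.

Let restrictG y : B y ->
  (\int[m1]_(x in A) f (x, y) = \int[m1]_x (f \_ (A `*` B)) (x, y))%E.
Proof.
move=> By; rewrite integral_mkcond; apply: eq_integral => x _.
by rewrite !patchE in_setX (mem_set By) andbT.
Qed.

Lemma measurable_fubini_in :
  measurable_fun B (fun y => \int[m1]_(x in A) f (x, y))%E.
Proof.
apply: (eq_measurable_fun (fubini_G m1 (f \_ (A `*` B)))).
  by move=> x /set_mem Ax; rewrite restrictG.
by apply: measurable_funTS; exact: measurable_fun_fubini_tonelli_G.
Qed.

Lemma fubini_tonelli_in :
  (\int[m1]_(x in A) \int[m2]_(y in B) f (x, y) =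
   \int[m2]_(y in B) \int[m1]_(x in A) f (x, y))%E.
Proof.
transitivity (\int[m1]_x fubini_F m2 (f \_ (A `*` B)) x)%E.
  rewrite integral_mkcond; apply: eq_integral => x _; rewrite patchE.
  case: ifPn => Ax; first by rewrite restrictF//; exact: set_mem.
  by rewrite /fubini_F integral0_eq// => y _; rewrite patchE in_setX (negbTE Ax).
rewrite (fubini_tonelli (f \_ (A `*` B)))//.
rewrite [RHS]integral_mkcond; apply: eq_integral => y _; rewrite patchE.
case: ifPn => By; first by rewrite restrictG//; exact: set_mem.
by rewrite /fubini_G integral0_eq// => x _; rewrite patchE in_setX (negbTE By) andbF.
Qed.

End fubini_in.

Lemma integral_xsection_ysection d1 d2 (T1 : measurableType d1)
    (T2 : measurableType d2) (R : realType)
    (m1 : {sigma_finite_measure set T1 -> \bar R})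
    (m2 : {sigma_finite_measure set T2 -> \bar R}) (S : set (T1 * T2)) :
  measurable S ->
  (\int[m1]_x m2 (xsection S x) = \int[m2]_y m1 (ysection S y))%E.
Proof.
move=> mS; apply: (@product_measure_unique _ _ _ _ _ m1 m2 (m1 \x^ m2)%E) => //.
by move=> A B mA mB /=; rewrite product_measure2E.
Qed.

Lemma measurable_le_set d (T : measurableType d) (R : realType) (f g : T -> R) :
  measurable_fun setT f -> measurable_fun setT g ->
  measurable [set x | f x <= g x].
Proof.
move=> mf mg; rewrite -[X in measurable X]setTI.
by apply: (measurable_fun_ler mf mg measurableT (Y := [set true])).
Qed.

Lemma measurable_lt_set d (T : measurableType d) (R : realType) (f g : T -> R) :
  measurable_fun setT f -> measurable_fun setT g ->
  measurable [set x | f x < g x].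
Proof.
move=> mf mg; rewrite -[X in measurable X]setTI.
by apply: (measurable_fun_ltr mf mg measurableT (Y := [set true])).
Qed.

(** * The integral of the derivative of a monotone function *)

Section derive1_open.
Context (R : realType) (E : set R) (B : R -> R).
Hypotheses (oE : open E) (dB : forall x, E x -> derivable B x 1).

Lemma open_near_left x : E x -> \forall k \near \oo, E (x - k.+1%:R^-1).
Proof.
move=> Ex.
have : (fun k => x - k.+1%:R^-1) @ \oo --> x.
  rewrite -[X in _ --> X]subr0; apply: cvgB; first exact: cvg_cst.
  exact: cvg_harmonic.
by move/(_ E); apply; exact: open_nbhs_nbhs.
Qed.

Lemma cvg_left_quotient x : E x ->
  (fun k => k.+1%:R * (B x - B (x - k.+1%:R^-1))) @ \oo --> derive1 B x.
Proof.
move=> Ex; have := dB Ex; rewrite /derivable /derive1 => /= dBx.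
have {}dBx : (fun h => h^-1 *: ((B \o shift x) h - B x)) @ 0^' --> derive1 B x.
  move: dBx; rewrite /derive1 /=.
  under eq_fun do rewrite [_%:A]mulr1.
  by move/cvg_ex => [l h]; rewrite (cvg_lim _ h).
have h0 : (fun k => - k.+1%:R^-1) @ \oo --> (0 : R)^'.
  move=> A /nbhs_ballP[e /= e0 eA].
  have [N _ hN] : \forall k \near \oo, k.+1%:R^-1 < e :> R.
    exact: near_infty_natSinv_lt (PosNum e0).
  exists N => //= k Nk; apply: eA => /=; last by rewrite oppr_eq0 invr_eq0 pnatr_eq0.
  by rewrite /ball/= opprK add0r gtr0_norm ?invr_gt0//; exact: hN.
have := cvg_comp _ _ h0 dBx.
apply: cvg_trans; apply: near_eq_cvg; apply: nearW => k /=.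
rewrite invrN invrK scaleNr -mulrN opprB addrC.
by rewrite [- _ + x]addrC [- B _ + _]addrC.
Qed.

Lemma measurable_derive1 : measurable_fun E (derive1 B).
Proof.
have mE : measurable E by exact: open_measurable.
have mB : measurable_fun setT (B \_ E).
  apply/(measurable_restrictT B mE).
  apply: open_continuous_measurable_fun => // x /set_mem Ex.
  by apply: differentiable_continuous; apply/derivable1_diffP; exact: dB.
apply: (@measurable_fun_cvg _ _ _ E
  (fun k x => k.+1%:R * ((B \_ E) x - (B \_ E) (x - k.+1%:R^-1)))).
  move=> k; apply: measurable_funTS; apply: measurable_funM => //.
  apply: measurable_funB => //.
  apply: (measurableT_comp mB); exact: measurable_funB.
move=> x Ex; apply: cvg_trans (cvg_left_quotient Ex).
apply: near_eq_cvg; near=> k.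
rewrite !patchE !mem_set//.
near: k; exact: open_near_left.
Unshelve. all: by end_near. Qed.

End derive1_open.

Lemma lebesgue_measure_le_diam (R : realType) (A : set R) (d : R) :
  measurable A -> 0 <= d -> (forall x y, A x -> A y -> y - x <= d) ->
  (@lebesgue_measure R A <= d%:E)%E.
Proof.
move=> mA d0 dA.
have [->|/set0P[x Ax]] := eqVneq A set0; first by rewrite measure0 lee_fin.
have hiA : has_inf A.
  by split; [exists x|exists (x - d) => y Ay; have := dA _ _ Ay Ax; lra].
have sub : A `<=` `[inf A, inf A + d].
  move=> y Ay; rewrite /= in_itv /= ge_inf//=; last by case: hiA.
  rewrite -lerBlDr; apply: lb_le_inf; first by exists x.
  by move=> z Az; have := dA _ _ Az Ay; lra.
apply: (@le_trans _ _ (@lebesgue_measure R `[inf A, inf A + d]%classic)).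
  by apply: le_measure => //; rewrite inE.
rewrite lebesgue_measure_itv /=; case: ifP => _; last by rewrite lee_fin.
by rewrite -EFinD lee_fin; lra.
Qed.

(* Fatou applied to the quotients [k (B x - B (x - 1/k))], where
   [B x - B (x - 1/k)] is the length of the values [s] jumped over at [x];
   for each [s] the points [x] jumping over it lie within [1/k] of each other. *)
Lemma integral_derive1_le (R : realType) (E : set R) (B : R -> R) (l u : R) :
  open E -> (forall x, E x -> derivable B x 1) ->
  {in E &, {homo B : x y / x <= y}} -> (forall x, E x -> l <= B x <= u) ->
  l <= u ->
  (\int[@lebesgue_measure R]_(x in E) (derive1 B x)%:E <= (u - l)%:E)%E.
Proof.
move=> oE dB ndB lBu lu.
have mE : measurable E by exact: open_measurable.
pose d k : R := k.+1%:R^-1.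
have d0 k : 0 < d k by rewrite invr_gt0.
pose S k := [set p : R * R | [/\ E p.1, E (p.1 - d k) & B (p.1 - d k) < p.2 <= B p.1]].
have mB : measurable_fun setT (B \_ E).
  apply/(measurable_restrictT B mE).
  apply: open_continuous_measurable_fun => // x /set_mem Ex.
  by apply: differentiable_continuous; apply/derivable1_diffP; exact: dB.
have mS k : measurable (S k).
  pose f1 (p : R * R) := (B \_ E) p.1.
  pose f2 (p : R * R) := (B \_ E) (p.1 - d k).
  have ms : measurable_fun setT (fun p : R * R => p.1 - d k) by exact: measurable_funB.
  have mf1 : measurable_fun setT f1 by exact: (measurableT_comp mB).
  have mf2 : measurable_fun setT f2 by exact: (measurableT_comp mB).
  have -> : S k = (fst @^-1` E `&` (fun p => p.1 - d k) @^-1` E) `&`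
     ([set p | f2 p < p.2] `&` [set p | p.2 <= f1 p]).
    apply/seteqP; split => [[x s]|[x s]]; rewrite /S /f1 /f2 /= !patchE.
      by move=> [Ex Ey /andP[]]; rewrite !mem_set.
    by move=> [[Ex Ey]]; rewrite !mem_set// => -[-> ->].
  apply: measurableI; first apply: measurableI.
  - by rewrite -[X in measurable X]setTI; exact: measurable_fst.
  - by rewrite -[X in measurable X]setTI; exact: ms.
  - apply: measurableI.
    + exact: measurable_lt_set.
    + exact: measurable_le_set.
pose mu := @lebesgue_measure R.
pose g k x : \bar R := (k.+1%:R%:E * mu (xsection (S k) x))%E.
have mg k : measurable_fun setT (g k).
  apply: measurable_funeM; exact: (measurable_fun_xsection mu (mS k)).
have g0 k x : (0 <= g k x)%E by rewrite mule_ge0// lee_fin.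
have gE k x : E x -> E (x - d k) -> g k x = (k.+1%:R * (B x - B (x - d k)))%:E.
  move=> Ex Ey; rewrite /g EFinM; congr (_ * _)%E.
  have -> : xsection (S k) x = `]B (x - d k), B x]%classic.
    apply/seteqP; split => s; rewrite /xsection /S /= in_itv /= ?inE /=.
      by move=> [].
    by [].
  rewrite /mu lebesgue_measure_itv /= lte_fin; case: ltP => // h.
  have : B (x - d k) <= B x by apply: ndB; rewrite ?mem_set//; have := d0 k; lra.
  by move=> h'; have -> : B (x - d k) = B x; [apply/eqP; rewrite eq_le h' h|rewrite subrr].
have lim x : E x -> limn_einf (g^~ x) = (derive1 B x)%:E.
  move=> Ex; have h : (g^~ x) @ \oo --> (derive1 B x)%:E.
    have : (fun k => (k.+1%:R * (B x - B (x - k.+1%:R^-1)))%:E) @ \oo --> (derive1 B x)%:E.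
      by apply: cvg_EFin; [exact: nearW|exact: (cvg_left_quotient dB Ex)].
    apply: cvg_trans; apply: near_eq_cvg; near=> k.
    rewrite gE//; near: k; exact: open_near_left.
  by rewrite (cvg_limn_einf_sup h).
have bnd k : (\int[mu]_(x in E) g k x <= (u - l)%:E)%E.
  apply: (@le_trans _ _ (\int[mu]_x g k x)%E); first by apply: ge0_subset_integral => //; exact: mg.
  rewrite ge0_integralZl//; last exact: (measurable_fun_xsection mu (mS k)).
  have -> : (\int[mu]_x mu (xsection (S k) x) = \int[mu]_s mu (ysection (S k) s))%E.
    exact: (integral_xsection_ysection mu mu (mS k)).
  apply: (@le_trans _ _ (k.+1%:R%:E * \int[mu]_s ((d k)%:E * (\1_`]l, u] s)%:E))%E).
    rewrite lee_pmul2l ?lte_fin//.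
    apply: ge0_le_integral => //.
    - exact: (measurable_fun_ysection mu (mS k)).
    - by apply: measurable_funeM; apply/measurable_EFinP; exact: measurable_indic.
    move=> s _.
    have [ls|ls] := boolP (s \in `]l, u]%classic); last first.
      rewrite (_ : ysection _ _ = set0).
        rewrite /mu measure0; by rewrite mule_ge0// lee_fin ltW.
      apply/seteqP; split => // x; rewrite /ysection /S /= inE /= => -[Ex Ey /andP[h1 h2]].
      move/negP: ls; apply; rewrite inE /= in_itv /=.
      by have := lBu _ Ex; have := lBu _ Ey; lra.
    rewrite indicE ls mule1; apply: lebesgue_measure_le_diam; last 2 first.
    - exact: ltW.
    - move=> x y; rewrite /ysection /S /= !inE /= => -[Ex Ex' /andP[h1 h2]] [Ey Ey' /andP[h3 h4]].
      rewrite leNgt; apply/negP => h.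
      have : B x <= B (y - d k) by apply: ndB; rewrite ?mem_set//; lra.
      by lra.
    exact: measurable_ysection.
  rewrite ge0_integralZl//; last 2 first.
  - by apply/measurable_EFinP; exact: measurable_indic.
  - by rewrite lee_fin ltW.
  rewrite muleA -EFinM mulfV ?mul1e ?pnatr_eq0//.
  rewrite integral_indic// setIT.
  suff : (@lebesgue_measure R `]l, u]%classic <= (u - l)%:E)%E by [].
  rewrite lebesgue_measure_itv /= lte_fin.
  by case: ifP => //; rewrite lee_fin subr_ge0.
apply: (le_trans _ (_ : limn_einf (fun k => \int[mu]_(x in E) g k x) <= (u - l)%:E)%E).
  have := @fatou _ _ _ mu E mE g
    (fun k => measurable_funS measurableT (@subsetT _ E) (mg k)) (fun k x _ => g0 k x).
  by under eq_integral => x xE do rewrite (lim _ (set_mem xE)).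
rewrite limn_einf_lim.
apply: lime_le; first exact: is_cvg_einfs.
apply: nearW => k; apply: le_trans (bnd k).
by apply: ereal_inf_lbound; exists k => /=.
Unshelve. all: by end_near. Qed.

(** * Atomless laws on the line *)

Section monotone_bounds.
Context d (T : measurableType d) (R : realType) (mu : probability T R).
Variables (F : (set T)^nat) (a : \bar R).
Hypothesis mF : forall k, measurable (F k).

Lemma measure_bigcup_le : {homo F : m n / (m <= n)%N >-> m `<=` n} ->
  (forall k, mu (F k) <= a)%E -> (mu (\bigcup_k F k) <= a)%E.
Proof.
move=> ndF Fa; have h : (mu \o F) @ \oo --> mu (\bigcup_k F k).
  apply: nondecreasing_cvg_mu => //; first exact: bigcup_measurable.
  by move=> m n mn; apply/subsetPset; exact: ndF.
by rewrite -(cvg_lim _ h)//; apply: lime_le; [apply: cvgP h|exact: nearW].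
Qed.

Lemma measure_bigcap_ge : {homo F : m n / (m <= n)%N >-> n `<=` m} ->
  (forall k, a <= mu (F k))%E -> (a <= mu (\bigcap_k F k))%E.
Proof.
move=> ndF Fa; have h : (mu \o F) @ \oo --> mu (\bigcap_k F k).
  apply: nonincreasing_cvg_mu => //.
  - by rewrite (le_lt_trans (probability_le1 _ _)) ?ltry.
  - exact: bigcap_measurable.
  - by move=> m n mn; apply/subsetPset; exact: ndF.
by rewrite -(cvg_lim _ h)//; apply: lime_ge; [apply: cvgP h|exact: nearW].
Qed.

End monotone_bounds.

Lemma cdf_mono (R : realType) (mu : probability R R) x y : x <= y ->
  (mu `]-oo, x]%classic <= mu `]-oo, y]%classic)%E.
Proof. by move=> xy; apply: le_measure; rewrite ?inE//; exact: subitvPr. Qed.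

Section atomless.
Context (R : realType) (mu : probability R R).
Hypothesis mu1 : forall x, mu [set x] = 0%E.

Lemma atomless_itv x : mu `]-oo, x[%classic = mu `]-oo, x]%classic.
Proof.
rewrite -(setUitv1 true)// measureU//=; last first.
  by apply/seteqP; split => // y [] /= /[swap] ->; rewrite in_itv/= ltxx.
by rewrite mu1 adde0.
Qed.

Lemma atomless_itvy x : mu `[x, +oo[%classic = (1 - mu `]-oo, x]%classic)%E.
Proof.
rewrite -(atomless_itv x) -probability_setC//; congr (mu _).
by apply/seteqP; split => z /=; rewrite !in_itv/= andbT leNgt => /negP.
Qed.

Lemma atomless_quantile (a : R) : 0 < a < 1 ->
  mu `]-oo, inf [set x | (a%:E <= mu `]-oo, x]%classic)%E]]%classic = a%:E.
Proof.
move=> /andP[a0 a1]; set S := (X in inf X).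
have mono x y := @cdf_mono R mu x y.
have upS x y : S x -> x <= y -> S y.
  by move=> Sx xy; exact: le_trans (mono _ _ xy).
have S0 : S !=set0.
  apply: contrapT => S0.
  suff : (mu setT <= a%:E)%E by rewrite probability_setT lee_fin leNgt a1.
  have <- : \bigcup_k `]-oo, (k%:R : R)]%classic = [set: R].
    apply/seteqP; split => // x _; exists (Num.truncn x).+1 => //=.
    by rewrite in_itv/= ltW// truncnS_gt.
  apply: measure_bigcup_le => // [m n mn|k].
    by apply: subitvPr; rewrite bnd_simp ler_nat.
  by rewrite leNgt; apply/negP => h; apply: S0; exists k%:R; exact: ltW.
have lbS : has_lbound S.
  apply: contrapT => nb.
  suff : (a%:E <= mu set0)%E by rewrite measure0 lee_fin leNgt a0.
  have <- : \bigcap_k `]-oo, (- k%:R : R)]%classic = set0.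
    apply/seteqP; split => // x /(_ (Num.truncn (- x)).+1 I)/=.
    by rewrite in_itv/= leNgt => /negP; apply; rewrite ltrNl truncnS_gt.
  apply: measure_bigcap_ge => // [m n mn|k].
    by apply: subitvPr; rewrite bnd_simp lerN2 ler_nat.
  suff [x [Sx xk]] : exists x, S x /\ x <= - k%:R by exact: upS xk.
  apply: contrapT => h; apply: nb; exists (- k%:R) => x Sx.
  by rewrite leNgt; apply/negP => xk; apply: h; exists x; rewrite ltW.
apply/eqP; rewrite eq_le; apply/andP; split.
  rewrite -atomless_itv.
  have -> : `]-oo, inf S[%classic = \bigcup_k `]-oo, inf S - k.+1%:R^-1]%classic.
    apply/seteqP; split => x /=; rewrite in_itv/=.
      move=> xS; have : 0 < inf S - x by rewrite subr_gt0.
      move=> S_x; have [k _ /(_ _ (leqnn k))/= kS] := near_infty_natSinv_lt (PosNum S_x).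
      by exists k => //=; rewrite in_itv/= lerBrDr -lerBrDl ltW.
    by move=> [k _] /=; rewrite in_itv/= => /le_lt_trans; apply; rewrite ltrBlDr ltrDl.
  apply: measure_bigcup_le => // [m n mn|k].
    apply: subitvPr; rewrite bnd_simp lerD2l lerN2 lef_pV2 ?posrE// ler_nat//.
  rewrite ltW// ltNge; apply/negP => h.
  have /(ge_inf lbS) : S (inf S - k.+1%:R^-1) by [].
  by rewrite lerBrDr gerDl leNgt invr_gt0 ltr0n.
have -> : `]-oo, inf S]%classic = \bigcap_k `]-oo, inf S + k.+1%:R^-1]%classic.
  apply/seteqP; split => x /=; rewrite in_itv/=.
    by move=> xS k _ /=; rewrite in_itv/= (le_trans xS)// lerDl.
  move=> h; apply/ler_addgt0Pr => e e0.
  have [k _ /(_ _ (leqnn k))/= kS] := near_infty_natSinv_lt (PosNum e0).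
  by have := h k I; rewrite /= in_itv/= => /le_trans; apply; rewrite lerD2l ltW.
apply: measure_bigcap_ge => // [m n mn|k].
  by apply: subitvPr; rewrite bnd_simp lerD2l lef_pV2 ?posrE// ler_nat.
have [x Sx xk] : exists2 x, S x & x < inf S + k.+1%:R^-1.
  by apply: inf_adherent; [rewrite invr_gt0|split].
exact: upS (ltW xk).
Qed.

Lemma atomless_uniform (a : R) : 0 < a < 1 ->
  mu [set x | (mu `]-oo, x]%classic <= a%:E)%E] = a%:E.
Proof.
move=> a01; have /andP[a0 a1] := a01.
have mono x y := @cdf_mono R mu x y.
set D := [set x | _].
have mD : measurable D.
  apply: is_interval_measurable => x y Dx Dy z /andP[xz zy].
  exact: le_trans (mono _ _ zy) Dy.
apply/eqP; rewrite eq_le; apply/andP; split; last first.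
  rewrite -[leLHS](atomless_quantile a01).
  apply: le_measure; rewrite ?inE// => x /=; rewrite in_itv/= => xq.
  by apply: (le_trans (mono _ _ xq)); rewrite atomless_quantile.
apply/lee_addgt0Pr => e e0.
have [ae|ae] := ltP (a + e) 1; last first.
  by rewrite (le_trans (probability_le1 _ _))// -EFinD lee_fin.
have ae01 : 0 < a + e < 1 by rewrite ae addr_gt0.
rewrite -EFinD -[leRHS](atomless_quantile ae01).
apply: le_measure; rewrite ?inE// => x /= xa; rewrite in_itv/=.
rewrite leNgt; apply/negP => /ltW/mono; rewrite atomless_quantile//.
by move/le_trans => /(_ _ xa); rewrite lee_fin leNgt ltrDl e0.
Qed.

Lemma atomless_uniform_closed (a : R) : 0 <= a <= 1 ->
  mu [set x | (mu `]-oo, x]%classic <= a%:E)%E] = a%:E.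
Proof.
move=> /andP[a0 a1].
have [a1'|a1'] := ltP a 1; last first.
  have -> : a = 1 by apply/eqP; rewrite eq_le a1 a1'.
  rewrite -[RHS](@probability_setT _ _ _ mu); congr (mu _).
  by apply/seteqP; split => // x _ /=; exact: probability_le1.
move: a0; rewrite le_eqVlt => /orP[/eqP <-|a0]; last exact/atomless_uniform/andP.
have mono x y := @cdf_mono R mu x y.
have mD (b : \bar R) : measurable [set x | (mu `]-oo, x]%classic <= b)%E].
  apply: is_interval_measurable => x y Dx Dy z /andP[xz zy].
  exact: le_trans (mono _ _ zy) Dy.
apply/eqP; rewrite eq_le measure_ge0 andbT.
apply/lee_addgt0Pr => e e0; rewrite add0e.
have [e1|e1] := ltP e 1; last first.
  by rewrite (le_trans (probability_le1 _ _)).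
have e01 : 0 < e < 1 by rewrite e0.
rewrite -[leRHS](atomless_uniform e01); apply: le_measure; rewrite ?inE//.
by move=> x /= /le_trans; apply; rewrite lee_fin ltW.
Qed.

End atomless.

(** * Confidence densities and coverage *)

Lemma derive1_ge0 (R : realType) (E : set R) (B : R -> R) : open E ->
  (forall x, E x -> derivable B x 1) -> {in E &, {homo B : x y / x <= y}} ->
  forall x, E x -> 0 <= derive1 B x.
Proof.
move=> oE dB ndB x Ex; have h := cvg_left_quotient dB Ex.
rewrite -(cvg_lim _ h)//; apply: limr_ge; first exact: cvgP h.
near=> k; rewrite mulr_ge0// subr_ge0; apply: ndB; rewrite ?mem_set//.
  by near: k; exact: open_near_left.
by rewrite lerBlDr lerDl.
Unshelve. all: by end_near. Qed.

Section confidence_cdf.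
Context (R : realType) (Theta : set R).
Hypothesis oTheta : open Theta.
Local Notation mu := (@lebesgue_measure R).

Lemma open_ltNy x : open (Theta `&` [set z | (z < x)%R]).
Proof. by apply: openI => //; exact: open_lt. Qed.

Lemma open_gty x : open (Theta `&` [set z | (x < z)%R]).
Proof. by apply: openI => //; exact: open_gt. Qed.

Lemma ge0_integral_split_at (g : R -> R) (x : R) : measurable_fun Theta g ->
  (forall z, Theta z -> 0 <= g z) ->
  (\int[mu]_(z in Theta) (g z)%:E =
   \int[mu]_(z in Theta `&` [set z | (z < x)%R]) (g z)%:E +
   \int[mu]_(z in Theta `&` [set z | (x < z)%R]) (g z)%:E)%E.
Proof.
move=> mg g0; have mT : measurable Theta by exact: open_measurable.
have meg : measurable_fun Theta (EFin \o g) by exact/measurable_EFinP.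
rewrite (@ge0_negligible_integral _ _ _ mu Theta [set x])//; last exact: lebesgue_measure_set1.
have -> : Theta `\` [set x] =
  (Theta `&` [set z | (z < x)%R]) `|` (Theta `&` [set z | (x < z)%R]).
  rewrite -setIUr; apply/seteqP; split => z /= [Tz]; last first.
    by move=> zx; split => // zx'; move: zx; rewrite zx' ltxx => -[].
  by move=> /eqP; rewrite neq_lt => /orP.
rewrite ge0_integral_setU//=.
- apply: open_measurable; exact: open_ltNy.
- apply: open_measurable; exact: open_gty.
- by apply: measurable_funS meg => //; rewrite -setIUr; exact: subIsetl.
- by move=> z [] [Tz _]; rewrite lee_fin g0.
- apply/disj_setPS => z [[_ /= h1] [_ /= h2]].
  by have := lt_trans h1 h2; rewrite ltxx.
Qed.

Lemma conf_cdf_nondecreasing (A : R -> R) (x : R) :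
  (forall z, Theta z -> derivable A z 1) ->
  (forall z, Theta z -> 0 <= A z <= 1) ->
  {in Theta &, {homo A : y z / y <= z}} ->
  (\int[mu]_(z in Theta) (`|derive1 A z|)%:E = 1)%E -> Theta x ->
  (\int[mu]_(z in Theta `&` [set z | (z < x)%R]) (`|derive1 A z|)%:E = (A x)%:E /\
  \int[mu]_(z in Theta `&` [set z | (x < z)%R]) (`|derive1 A z|)%:E = (1 - A x)%:E)%E.
Proof.
move=> dA A01 ndA int1 Tx.
have absE S : (\int[mu]_(z in Theta `&` S) (`|derive1 A z|)%:E =
    \int[mu]_(z in Theta `&` S) (derive1 A z)%:E)%E.
  by apply: eq_integral => z /set_mem [Tz _]; rewrite ger0_norm// (derive1_ge0 oTheta).
move: int1; rewrite (ge0_integral_split_at x)//; last first.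
  by apply: measurableT_comp => //; exact: measurable_derive1.
have hl : (\int[mu]_(z in Theta `&` [set z | (z < x)%R]) (`|derive1 A z|)%:E <= (A x - 0)%:E)%E.
  rewrite absE; apply: integral_derive1_le.
  - exact: open_ltNy.
  - by move=> z [Tz _]; exact: dA.
  - by move=> y z /set_mem [Ty _] /set_mem[Tz _]; apply: ndA; rewrite mem_set.
  - move=> z [Tz /= zx]; have /andP[-> _] := A01 _ Tz.
    by apply: ndA; rewrite ?mem_set// ltW.
  - by have /andP[] := A01 _ Tx.
have hr : (\int[mu]_(z in Theta `&` [set z | (x < z)%R]) (`|derive1 A z|)%:E <= (1 - A x)%:E)%E.
  rewrite absE; apply: integral_derive1_le.
  - exact: open_gty.
  - by move=> z [Tz _]; exact: dA.
  - by move=> y z /set_mem [Ty _] /set_mem[Tz _]; apply: ndA; rewrite mem_set.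
  - move=> z [Tz /= zx]; have /andP[_ ->] := A01 _ Tz; rewrite andbT.
    by apply: ndA; rewrite ?mem_set// ltW.
  - by have /andP[] := A01 _ Tx.
have hl0 : (0 <= \int[mu]_(z in Theta `&` [set z | (z < x)%R]) (`|derive1 A z|)%:E)%E.
  by apply: integral_ge0 => z _; rewrite lee_fin.
have hr0 : (0 <= \int[mu]_(z in Theta `&` [set z | (x < z)%R]) (`|derive1 A z|)%:E)%E.
  by apply: integral_ge0 => z _; rewrite lee_fin.
move: hl hr hl0 hr0; set a := integral _ _ _; set b := integral _ _ _.
case: a => [a| |]; case: b => [b| |] //=.
rewrite !lee_fin -EFinD => h1 h2 h3 h4 [h5].
split; congr EFin; lra.
Qed.

Lemma conf_cdf_nonincreasing (A : R -> R) (x : R) :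
  (forall z, Theta z -> derivable A z 1) ->
  (forall z, Theta z -> 0 <= A z <= 1) ->
  {in Theta &, {homo A : y z /~ y <= z}} ->
  (\int[mu]_(z in Theta) (`|derive1 A z|)%:E = 1)%E -> Theta x ->
  (\int[mu]_(z in Theta `&` [set z | (z < x)%R]) (`|derive1 A z|)%:E = (1 - A x)%:E /\
  \int[mu]_(z in Theta `&` [set z | (x < z)%R]) (`|derive1 A z|)%:E = (A x)%:E)%E.
Proof.
move=> dA A01 ndA int1 Tx.
pose A' z := 1 - A z.
have dA' z : Theta z -> derivable A' z 1.
  by move=> Tz; apply: derivableB; [exact: derivable_cst|exact: dA].
have eA' z : Theta z -> `|derive1 A z| = `|derive1 A' z|.
  move=> Tz; rewrite !derive1E /A' deriveB//; last exact: dA.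
  by rewrite derive_cst sub0r normrN.
have eqi S : (\int[mu]_(z in Theta `&` S) (`|derive1 A z|)%:E =
              \int[mu]_(z in Theta `&` S) (`|derive1 A' z|)%:E)%E.
  by apply: eq_integral => z /set_mem [Tz _]; rewrite eA'.
rewrite !eqi.
have A01' z : Theta z -> 0 <= A' z <= 1.
  by move=> Tz; rewrite /A'; have := A01 _ Tz; lra.
have ndA' : {in Theta &, {homo A' : y z / y <= z}}.
  by move=> y z yT zT yz; rewrite /A' lerD2l lerN2; exact: ndA.
have int1' : (\int[mu]_(z in Theta) (`|derive1 A' z|)%:E = 1)%E.
  by have := eqi setT; rewrite !setIT int1 => <-.
have [-> ->] := conf_cdf_nondecreasing dA' A01' ndA' int1' Tx.
by split => //; congr EFin; rewrite /A'; lra.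
Qed.

End confidence_cdf.

Lemma coverage_squeeze d (W : measurableType d) (R : realType)
  (P : probability W R) (V : W -> R) (N E : set W) (p r : R) :
  measurable N -> P N = 0%E ->
  (forall a, 0 < a < 1 -> exists F, [/\ measurable F, P F = a%:E &
     forall w, ~ N w -> F w <-> V w <= a]) ->
  measurable E -> 0 <= p -> p <= r -> r <= 1 ->
  (forall w, ~ N w -> p < V w < r -> E w) ->
  (forall w, ~ N w -> E w -> p <= V w <= r) ->
  P E = (r - p)%:E.
Proof.
move=> mN N0 hF mE p0 pr r1 inE' outE.
have PN (A B : set W) : measurable A -> measurable B -> A `<=` B `|` N -> (P A <= P B)%E.
  move=> mA mB AB; apply: (@le_trans _ _ (P (B `|` N))).
    by apply: le_measure; rewrite ?inE//; exact: measurableU.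
  by rewrite -[leRHS]adde0 -N0; exact: measureU2.
have up e : 0 < e -> exists F, [/\ measurable F, (P F <= (r + e)%:E)%E &
    forall w, ~ N w -> V w <= r -> F w].
  move=> e0; have [re1|re1] := ltP (r + e) 1; last first.
    exists setT; split => //; rewrite (le_trans (probability_le1 _ _))//.
  have [|F [mF PF FE]] := hF (r + e); first by rewrite re1 andbT; lra.
  by exists F; split => //; [rewrite PF|move=> w Nw Vw; apply/FE => //; lra].
have lo e : 0 < e -> exists F, [/\ measurable F, ((p - e)%:E <= P F)%E &
    forall w, ~ N w -> F w -> V w < p].
  move=> e0; have [pe0|pe0] := ltP 0 (p - e); last first.
    by exists set0; split => //; rewrite measure0 lee_fin.
  have [|F [mF PF FE]] := hF (p - e); first by rewrite pe0; lra.
  exists F; split => //; [by rewrite PF|move=> w Nw /FE => /(_ Nw)]; lra.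
apply/eqP; rewrite eq_le; apply/andP; split.
  apply/lee_addgt0Pr => e e0.
  have e20 : 0 < e / 2 by lra.
  have [F [mF PF FE]] := up _ e20; have [G [mG PG GE]] := lo _ e20.
  have dis : E `&` G `<=` N.
    move=> w [Ew Gw]; apply: contrapT => Nw.
    by have := GE _ Nw Gw; have := outE _ Nw Ew; lra.
  have h1 : (P ((E `\` G) `|` G) <= P F)%E.
    apply: PN => //; first by apply: measurableU => //; exact: measurableD.
    move=> w EG; have [Nw|Nw] := pselect (N w); [by right|left].
    apply: FE => //; case: EG => [[Ew _]|Gw].
      by have := outE _ Nw Ew; lra.
    by have := GE _ Nw Gw; lra.
  rewrite measureU//= in h1; last 2 first.
  - exact: measurableD.
  - by apply/seteqP; split => // w [[]].
  have h2 : P (E `\` G) = P E.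
    have PEG : P (E `&` G) = 0%E.
      apply/eqP; rewrite eq_le measure_ge0 andbT -N0.
      by apply: le_measure; rewrite ?inE//; exact: measurableI.
    transitivity (P E - P (E `&` G))%E; last by rewrite PEG sube0.
    by apply: measureD => //; rewrite (le_lt_trans (probability_le1 _ _)) ?ltry.
  have {}h1 : (P E + P G <= P F)%E by rewrite -h2; exact: h1.
  move: h1 PF PG; rewrite -(fineK (fin_num_measure P E mE)).
  rewrite -(fineK (fin_num_measure P F mF)) -(fineK (fin_num_measure P G mG)).
  rewrite -!EFinD !lee_fin; lra.
apply/lee_subgt0Pr => e e0; rewrite -EFinB.
have e20 : 0 < e / 2 by lra.
have [h|h] := ltP (p + e / 2) (r - e / 2); last first.
  by apply: le_trans (measure_ge0 _ _); rewrite lee_fin; lra.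
have [|F [mF PF FE]] := hF (r - e / 2); first by lra.
have [|G [mG PG GE]] := hF (p + e / 2); first by lra.
apply: (@le_trans _ _ (P (F `\` G))); last first.
  apply: PN => //; first exact: measurableD.
  move=> w [Fw Gw]; have [Nw|Nw] := pselect (N w); [by right|left].
  apply: inE' => //; move/FE: Fw => /(_ Nw) Fw.
  have : ~ (V w <= p + e / 2) by move=> h'; apply: Gw; apply/GE.
  by move/negP; rewrite -ltNge; lra.
have : (P F <= P (F `\` G) + P G)%E.
  apply: (le_trans _ (measureU2 _ _ _)) => //; last exact: measurableD.
  apply: le_measure; rewrite ?inE//; first by apply: measurableU => //; exact: measurableD.
  by move=> w Fw; have [Gw|Gw] := pselect (G w); [right|left].
rewrite PF PG -(fineK (fin_num_measure P _ (measurableD mF mG))).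
rewrite -!EFinD !lee_fin; lra.
Qed.

(** * Independence of the sample and the future value *)

Section independence.
Context d (W : measurableType d) (R : realType) (P : probability W R).

Lemma independent_joint (Y Z : {mfun W >-> R}) (S : set (R * R)) :
  (forall A B, measurable A -> measurable B ->
    P (Y @^-1` A `&` Z @^-1` B) = P (Y @^-1` A) * P (Z @^-1` B))%E ->
  measurable S ->
  P [set w | S (Y w, Z w)] =
  (\int[distribution P (Y : {RV P >-> R})]_t
     distribution P (Z : {RV P >-> R}) (xsection S t))%E.
Proof.
move=> indep mS.
have mYZ : measurable_fun setT (fun w => (Y w, Z w)) by exact: measurable_fun_pair.
pose mf : {mfun W >-> (R * R)%type} := mfun_Sub (mem_set mYZ).
apply/esym.
exact: (@product_measure_unique _ _ _ _ _ (distribution P (Y : {RV P >-> R}))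
  (distribution P (Z : {RV P >-> R})) (distribution P (mf : {RV P >-> (R * R)%type}))).
Qed.

Variables (n : nat) (X : 'I_n.+1 -> {mfun W >-> R}).

Let box (B : 'I_n -> set R) : set (n.-tuple R) := [set y | forall i, B i (tnth y i)].
Let boxes : set (set (n.-tuple R)) :=
  [set C | exists2 B, (forall i, measurable (B i)) & C = box B].

Let measurable_boxes : measurable = <<s boxes >>.
Proof.
apply/seteqP; split.
- apply: smallest_sub; first exact: smallest_sigma_algebra.
  elim/big_ind: _ => [//|A B hA hB C [/hA|/hB]//|i _ C [A mA <-]].
  apply: sub_sigma_algebra; exists (fun j => if j == i then A else setT).
    by move=> j; case: ifP.
  rewrite setTI; apply/seteqP; split => y /=.
    by move=> Ay j; case: eqVneq => // ->.
  by move=> /(_ i); rewrite eqxx.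
- apply: smallest_sub; first exact: sigma_algebra_measurable.
  move=> C [B mB ->].
  have -> : box B = \bigcap_(i in [set: 'I_n]) ((fun y => tnth y i) @^-1` B i).
    by apply/seteqP; split => y /= h i; [move=> _; exact: h|exact: h].
  apply: fin_bigcap_measurable => // i _.
  by rewrite -[X in measurable X]setTI; exact: measurable_tnth.
Qed.

Hypothesis indep : mutually_independent P X.

Let independent_box B A : (forall i, measurable (B i)) -> measurable A ->
  (P (sample X @^-1` (box B) `&` X ord_max @^-1` A) =
   (\prod_(i < n) P (X (widen_ord (leqnSn n) i) @^-1` B i)) * P (X ord_max @^-1` A))%E.
Proof.
move=> mB mA.
pose A' (i : 'I_n.+1) := if unlift ord_max i is Some j then B j else A.
have wE i : widen_ord (leqnSn n) i = lift ord_max i.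
  by apply: val_inj; rewrite /= /bump leqNgt ltn_ord.
have A'w i : A' (widen_ord (leqnSn n) i) = B i by rewrite /A' wE liftK.
have A'm : A' ord_max = A by rewrite /A' unlift_none.
have mA' i : measurable (A' i) by rewrite /A'; case: unliftP.
have := @indep [set: 'I_n.+1]%SET A' (fun i _ => mA' i).
rewrite (eq_bigl xpredT) => [|i]; last by rewrite finset.in_setT.
rewrite big_ord_recr /= A'm.
under eq_bigr do rewrite A'w.
move=> <-.
congr (P _); apply/seteqP; split => w /=.
  move=> [Bw Aw] i _; rewrite /A'; case: unliftP => [j ->|->] //.
  by have := Bw j; rewrite tnth_mktuple wE.
move=> h; split.
  move=> i; rewrite tnth_mktuple -[X in X _]A'w; apply: h.
  by rewrite /= finset.in_setT.
by rewrite -A'm; apply: h; rewrite /= finset.in_setT.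
Qed.

Lemma independent_sample B A : measurable B -> measurable A ->
  (P (sample X @^-1` B `&` X ord_max @^-1` A) =
   P (sample X @^-1` B) * P (X ord_max @^-1` A))%E.
Proof.
move=> mB mA.
have mUA : measurable (X ord_max @^-1` A).
  by rewrite -[X in measurable X]setTI; exact: measurable_funPT.
pose m1 := pushforward (mrestr P mUA) (sample X).
pose m2 := mscale (NngNum (fine_ge0 (measure_ge0 P (X ord_max @^-1` A))))
   (distribution P (sample X)).
suff : m1 B = m2 B.
  rewrite /m1 /m2 /mscale/= fineK ?fin_num_measure// muleC; exact.
apply: (measure_unique boxes (fun _ => setT)) => //.
- move=> _ _ [B1 mB1 ->] [B2 mB2 ->]; exists (fun i => B1 i `&` B2 i).
    by move=> i; exact: measurableI.
  by apply/seteqP; split => y /= => [[h1 h2] i|h]; [split|split => i; have [] := h i].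
- move=> _; exists (fun _ => setT) => //.
  by apply/seteqP; split.
- by rewrite bigcup_const//; exists 0%N.
- move=> _ [C mC ->].
  suff : (P (sample X @^-1` box C `&` X ord_max @^-1` A) =
      (fine (P (X ord_max @^-1` A)))%:E * P (sample X @^-1` box C))%E by [].
  rewrite fineK ?fin_num_measure//.
  have := independent_box mC mA.
  have := independent_box mC measurableT.
  rewrite preimage_setT setIT probability_setT mule1 => <- h.
  by rewrite muleC -h.
- move=> _; apply: (@le_lt_trans _ _ 1%E); last exact: ltry.
  by apply: probability_le1; apply: measurableI => //; rewrite preimage_setT.
Qed.
End independence.

(** * Positive densities on an interval *)

Section density_probability.
Context (R : realType).
Local Notation mu := (@lebesgue_measure R).
Variable g : R -> \bar R.
Hypotheses (mg : measurable_fun setT g) (g0 : forall x, (0 <= g x)%E)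
  (g1 : (\int[mu]_x g x = 1)%E).

Let dprob (A : set R) : \bar R := (\int[mu]_(x in A) g x)%E.

Let dprob0 : dprob set0 = 0%E. Proof. exact: integral_set0. Qed.

Let dprob_ge0 A : (0 <= dprob A)%E.
Proof. by apply: integral_ge0 => x _; exact: g0. Qed.

Let dprob_sigma_additive : semi_sigma_additive dprob.
Proof.
move=> /= F mF tF mUF; rewrite /dprob; apply: cvg_toP.
  apply: ereal_nondecreasing_is_cvgn => m n mn.
  by apply: lee_sum_nneg_natr => // k _ _; exact: dprob_ge0.
by rewrite ge0_integral_bigcup//=; exact: measurable_funTS.
Qed.

HB.instance Definition _ := isMeasure.Build _ _ _
  dprob dprob0 dprob_ge0 dprob_sigma_additive.

Let dprob_setT : dprob [set: R] = 1%E. Proof. exact: g1. Qed.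

HB.instance Definition _ := @Measure_isProbability.Build _ _ R dprob dprob_setT.

Lemma density_probability :
  exists nu : probability R R, forall A, nu A = (\int[mu]_(x in A) g x)%E.
Proof. by exists dprob. Qed.

End density_probability.

Section positive_density.
Context (R : realType) (D : set R) (g : R -> \bar R) (nu : probability R R).
Hypotheses (iD : is_interval D) (mg : measurable_fun setT g)
  (g0 : forall u, (0 <= g u)%E) (gD : forall u, (0 < g u)%E <-> D u)
  (nuE : forall A, measurable A -> nu A = (\int[@lebesgue_measure R]_(u in A) g u)%E).

Lemma density_atomless x : nu [set x] = 0%E.
Proof.
rewrite nuE//; apply: null_set_integral => //; last exact: lebesgue_measure_set1.
exact: measurable_funTS.
Qed.

Lemma density_support : nu (~` D) = 0%E.
Proof.
have mD : measurable D by exact: is_interval_measurable.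
rewrite nuE; last exact: measurableC.
apply: integral0_eq => u /= Du; apply/eqP; rewrite eq_le g0 andbT leNgt.
by apply/negP => /gD.
Qed.

Lemma density_cdf_lt x y : D x -> D y -> x < y ->
  (nu `]-oo, x]%classic < nu `]-oo, y]%classic)%E.
Proof.
move=> Dx Dy xy; rewrite lt_neqAle cdf_mono ?ltW// andbT; apply/eqP => e.
have nuxy : nu `]x, y]%classic = 0%E.
  have h : nu `]-oo, y]%classic = (nu `]-oo, x]%classic + nu `]x, y]%classic)%E.
    have -> : `]-oo, y]%classic = `]-oo, x]%classic `|` `]x, y]%classic.
      apply/seteqP; split => z /=; rewrite !in_itv/=.
        by move=> zy; have [zx|xz] := leP z x; [left|right].
      by move=> [zx|/andP[]//]; rewrite (le_trans zx)// ltW.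
    apply: measureU => //; apply/seteqP; split => z //= [].
    by rewrite !in_itv/= => zx /andP[xz _]; move: (le_lt_trans zx xz); rewrite ltxx.
  have fK A : measurable A -> nu A = (fine (nu A))%:E.
    by move=> mA; rewrite fineK// fin_num_measure.
  move: h; rewrite -e (fK `]-oo, x]%classic)// (fK `]x, y]%classic)// -EFinD => -[h].
  by congr EFin; lra.
have mxy : measurable `]x, y]%classic by [].
have : ae_eq (@lebesgue_measure R) `]x, y]%classic g (cst 0%E).
  have mgxy : measurable_fun `]x, y]%classic g by exact: measurable_funTS.
  apply: (ae_eq_integral_abs (@lebesgue_measure R) mxy mgxy).1.
  by rewrite -[RHS]nuxy nuE//; apply: eq_integral => z _; rewrite gee0_abs.
move=> [N [mN N0 subN]].
have : `]x, y]%classic `<=` N.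
  move=> z xyz; apply: subN => /= /(_ xyz) gz0.
  have : D z.
    move: xyz; rewrite /= in_itv /= => /andP[xz zy].
    by apply: (iD Dx Dy); rewrite zy ltW.
  by move/gD; rewrite gz0 ltxx.
move=> xyN; have : (@lebesgue_measure R `]x, y]%classic <= 0)%E.
  by rewrite -N0; apply: le_measure => //; rewrite inE.
by apply/negP; rewrite -ltNge lebesgue_measure_itv/= lte_fin xy -EFinD lte_fin subr_gt0.
Qed.

Lemma density_quantile (a : R) : 0 < a < 1 ->
  [/\ D (quantile g a), nu `]-oo, quantile g a]%classic = a%:E &
   forall u, D u -> (nu `]-oo, u]%classic <= a%:E)%E <-> u <= quantile g a].
Proof.
move=> a01; have /andP[a0 a1] := a01; set q := quantile g a.
have nuq : nu `]-oo, q]%classic = a%:E.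
  have -> : q = inf [set x | (a%:E <= nu `]-oo, x]%classic)%E].
    by congr inf; apply/seteqP; split => x /=; rewrite nuE.
  by have := atomless_quantile density_atomless a01.
have Dq : D q.
  have mD : measurable D by exact: is_interval_measurable.
  have [x Dx xq] : exists2 x, D x & x <= q.
    apply: contrapT => h.
    have : (nu `]-oo, q]%classic <= nu (~` D))%E.
      apply: le_measure; rewrite ?inE//; first exact: measurableC.
      by move=> z /=; rewrite in_itv/= => zq Dz; apply: h; exists z.
    by rewrite density_support nuq lee_fin leNgt a0.
  have [y Dy qy] : exists2 y, D y & q <= y.
    apply: contrapT => h.
    have : (nu (~` `]-oo, q]%classic) <= nu (~` D))%E.
      apply: le_measure; rewrite ?inE//; first exact: measurableC.
        exact: measurableC.
      move=> z /=; rewrite in_itv/= => /negP; rewrite -ltNge => qz Dz.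
      by apply: h; exists z => //; exact: ltW.
    rewrite density_support probability_setC// nuq -EFinB lee_fin; lra.
  by apply: (iD Dx Dy); rewrite xq.
split => // u Du; split => [|uq].
  move=> h; rewrite leNgt; apply/negP => qu.
  by have := density_cdf_lt Dq Du qu; rewrite nuq ltNge h.
by rewrite -nuq; exact: cdf_mono.
Qed.

Lemma density_between x : (0 < nu `]-oo, x]%classic)%E -> (nu `]-oo, x]%classic < 1)%E ->
  (exists2 y, D y & y < x) /\ (exists2 y, D y & x < y).
Proof.
have mD : measurable D by exact: is_interval_measurable.
move=> nu0 nu1; split; apply: contrapT => h.
  have : (nu `]-oo, x[%classic <= nu (~` D))%E.
    apply: le_measure; rewrite ?inE//; first exact: measurableC.
    by move=> z /=; rewrite in_itv/= => zq Dz; apply: h; exists z.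
  by rewrite density_support (atomless_itv density_atomless) leNgt nu0.
have : (nu (~` `]-oo, x]%classic) <= nu (~` D))%E.
  apply: le_measure; rewrite ?inE//; first exact: measurableC.
    exact: measurableC.
  move=> z /=; rewrite in_itv/= => /negP; rewrite -ltNge => qz Dz.
  by apply: h; exists z.
rewrite density_support probability_setC//.
by rewrite leNgt sube_gt0 nu1.
Qed.

End positive_density.

(** * Statistics with a symmetric distribution function *)

Lemma left_of_interval (R : realType) (I : set R) : is_interval (left_of I).
Proof. by move=> x y Ix Iy z /andP[xz zy] t It; exact: le_lt_trans zy (Iy _ It). Qed.

Section interval_mass.
Context (R : realType).
Local Notation mu := (@lebesgue_measure R).
Variables (D I : set R) (g : R -> \bar R) (p m : \bar R) (x : R).
Hypotheses (mD : measurable D) (mg : measurable_fun D g)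
  (g0 : forall u, D u -> (0 <= g u)%E).
Hypotheses (ID : I `<=` D) (iI : is_interval I).
Hypotheses (hp : (\int[mu]_(u in D `&` left_of I) g u = p)%E)
  (hm : (\int[mu]_(u in I) g u = m)%E).

Let mI : measurable I. Proof. exact: is_interval_measurable. Qed.

Let mL : measurable (D `&` left_of I).
Proof. by apply: measurableI => //; apply: is_interval_measurable; exact: left_of_interval. Qed.

Let mx : measurable (D `&` [set z | z < x]).
Proof. by apply: measurableI => //; exact: open_measurable. Qed.

Let LI : (\int[mu]_(u in (D `&` left_of I) `|` I) g u = p + m)%E.
Proof.
have sub : (D `&` left_of I) `|` I `<=` D by move=> z [[]|/ID].
rewrite ge0_integral_setU ?hp ?hm//.
- exact: measurable_funS mg.
- by move=> z /sub; exact: g0.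
- by apply/disj_setPS => z [[_ Lz] Iz]; have := Lz _ Iz; rewrite ltxx.
Qed.

Lemma interval_mass_le : (p + m <= \int[mu]_(u in D) g u)%E.
Proof.
by rewrite -LI; apply: ge0_subset_integral => //; [exact: measurableU|move=> z [[]|/ID]].
Qed.

Let C := (\int[mu]_(u in D `&` [set z | (z < x)%R]) g u)%E.

Lemma interval_mass_in : I x -> (p <= C)%E /\ (C <= p + m)%E.
Proof.
move=> Ix; split.
  rewrite -hp; apply: ge0_subset_integral => //.
  - by apply: measurable_funS mg => //; exact: subIsetl.
  - by move=> z [Dz _]; exact: g0.
  - by move=> z [Dz Lz]; split => //=; exact: Lz.
rewrite -LI; apply: ge0_subset_integral => //.
- exact: measurableU.
- by apply: measurable_funS mg => // z [[]|/ID].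
- by move=> z [[Dz _]|/ID Dz]; exact: g0.
move=> z [Dz /= zx]; have [Lz|Lz] := pselect (left_of I z); [by left|right].
have [y Iy yz] : exists2 y, I y & y <= z.
  apply: contrapT => h; apply: Lz => y Iy; rewrite ltNge; apply/negP => yz.
  by apply: h; exists y.
by apply: (iI Iy Ix); rewrite yz ltW.
Qed.

Lemma interval_mass_mem : (p < C)%E -> (C < p + m)%E -> I x.
Proof.
move=> pC Cpm; apply: contrapT => Ix.
have [Lx|Lx] := pselect (left_of I x).
  move: pC; apply/negP; rewrite -leNgt -hp; apply: ge0_subset_integral => //.
  - by apply: measurable_funS mg => //; exact: subIsetl.
  - by move=> z [Dz _]; exact: g0.
  - by move=> z [Dz /= zx]; split => // y Iy; exact: lt_trans zx (Lx _ Iy).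
have [y Iy yx] : exists2 y, I y & y <= x.
  apply: contrapT => h; apply: Lx => y Iy; rewrite ltNge; apply/negP => yz.
  by apply: h; exists y.
move: Cpm; apply/negP; rewrite -leNgt -LI; apply: ge0_subset_integral => //.
- exact: measurableU.
- by apply: measurable_funS mg => //; exact: subIsetl.
- by move=> z [Dz _]; exact: g0.
move=> z [[Dz Lz]|Iz]; split => //=; first exact: lt_le_trans (Lz _ Iy) yx.
  exact: ID.
rewrite ltNge; apply/negP => xz; apply: Ix; apply: (iI Iy Iz); exact/andP.
Qed.

End interval_mass.

Lemma monotone_on_measurable (R : realType) (A : set R) (g : R -> R) :
  measurable A -> monotone_on A g -> measurable_fun A g.
Proof.
move=> mA.
suff nd (h : R -> R) : {in A &, {homo h : x y / x <= y}} -> measurable_fun A h.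
  case=> [/nd//|ni]; rewrite -(opprK g); apply: measurableT_comp => //; apply: nd.
  by move=> x y Ax Ay xy; rewrite lerN2; exact: ni.
move=> ndh; apply: (measurability (@RGenCInfty.G R)) => [|_ [_ [r ->] <-]].
  exact: RGenCInfty.measurableE.
have -> : A `&` h @^-1` `[r, +oo[ =
    A `&` [set x | exists y, [/\ A y, y <= x & r <= h y]].
  apply/seteqP; split => x [Ax] /=; rewrite in_itv/= andbT.
    by move=> rx; split => //; exists x.
  move=> [y [Ay yx ry]]; split => //; apply: le_trans ry _.
  by apply: ndh; rewrite ?inE.
apply: measurableI => //; apply: is_interval_measurable.
move=> x y [x' [Ax xx' rx]] _ z /andP[xz _]; exists x'; split => //.
exact: le_trans xz.
Qed.

Section symmetric_statistic.
Context (R : realType) d (W : measurableType d).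
Variables (Theta : set R) (P : R -> probability W R) (Z : {mfun W >-> R})
  (Omega : set R) (eta : R -> R).
Hypotheses (oTheta : open Theta) (bij_eta : set_bij Theta Omega eta)
  (mono_eta : monotone_on Theta eta).
Hypothesis ZOmega : forall theta, Theta theta ->
  exists N, [/\ measurable N, P theta N = 0%E & forall w, ~ N w -> Omega (Z w)].
Hypothesis symF : forall t h, Omega t -> Omega h ->
  cdf_eta Theta P eta Z t h = cdf_eta Theta P eta Z h t.
Hypothesis dtail : forall t theta, Omega t -> Theta theta ->
  derivable (tail_prob P Z t) theta 1.

Lemma cdf_etaE (Y : {mfun W >-> R}) x theta : Theta theta ->
  cdf_eta Theta P eta Y x (eta theta) = P theta [set w | Y w <= x].
Proof.
move=> Tt; rewrite /cdf_eta /cdf /distribution /pushforward /=.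
rewrite pinvKV ?inE//; last by case: bij_eta.
Qed.

Lemma eta_Omega theta : Theta theta -> Omega (eta theta).
Proof. by case: bij_eta => h _ _; exact: h. Qed.

Lemma Omega_eta t : Omega t -> exists2 theta, Theta theta & eta theta = t.
Proof. by case: bij_eta => _ _ h /h. Qed.

Lemma eta_sign : exists2 s : R, s = 1 \/ s = -1 &
  forall x y, Theta x -> Theta y -> 0 < s * (y - x) -> eta x < eta y.
Proof.
have inj x y : Theta x -> Theta y -> eta x = eta y -> x = y.
  by case: bij_eta => _ h _ Tx Ty; apply: h; rewrite inE.
case: mono_eta => h; [exists 1; [by left|]|exists (-1); [by right|]] => x y Tx Ty.
  rewrite mul1r subr_gt0 => xy; rewrite lt_neqAle h ?inE ?ltW// andbT.
  by apply/eqP => /(inj _ _ Tx Ty) e; move: xy; rewrite e ltxx.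
rewrite mulN1r opprB subr_gt0 => yx; rewrite lt_neqAle h ?inE ?ltW// andbT.
by apply/eqP => /(inj _ _ Tx Ty) e; move: yx; rewrite e ltxx.
Qed.

Let mle x : measurable [set w | (Z w <= x)%R].
Proof. exact: measurable_le_set. Qed.

Let mlt x : measurable [set w | (Z w < x)%R].
Proof. exact: measurable_lt_set. Qed.

Lemma cdf_sym a b : Theta a -> Theta b ->
  P b [set w | (Z w <= eta a)%R] = P a [set w | (Z w <= eta b)%R].
Proof.
by move=> Ta Tb; rewrite -!cdf_etaE// symF//; exact: eta_Omega.
Qed.

Let L a b := fine (P b [set w | (Z w < eta a)%R]).

Let LE a b : P b [set w | (Z w < eta a)%R] = (L a b)%:E.
Proof. by rewrite fineK// fin_num_measure. Qed.

Lemma tail_probE t b : tail_prob P Z t b = 1 - fine (P b [set w | (Z w < t)%R]).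
Proof.
rewrite /tail_prob.
have -> : [set w | t <= Z w] = ~` [set w | (Z w < t)%R].
  by apply/seteqP; split => w /=; [rewrite leNgt => /negP|move/negP; rewrite -leNgt].
by rewrite probability_setC// fineB// fin_num_measure.
Qed.

Let cvgL a b (u : R^nat) : Theta a -> Theta b -> u @ \oo --> b ->
  L a (u k) @[k --> \oo] --> L a b.
Proof.
move=> Ta Tb ub.
have ct : {for b, continuous (tail_prob P Z (eta a))}.
  apply: differentiable_continuous; apply/derivable1_diffP.
  by apply: dtail => //; exact: eta_Omega.
have -> : L a b = 1 - tail_prob P Z (eta a) b by rewrite tail_probE /L; lra.
have -> : (fun k => L a (u k)) = (fun k => 1 - tail_prob P Z (eta a) (u k)).
  by apply/funext => k; rewrite tail_probE /L; lra.
apply: cvgB; first exact: cvg_cst.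
exact: (cvg_comp _ _ ub ct).
Qed.

Let cvg_shift (s b : R) : (b + s * k.+1%:R^-1) @[k --> \oo] --> b.
Proof.
rewrite -[X in _ --> X]addr0; apply: cvgD; first exact: cvg_cst.
rewrite -[X in _ --> X](mulr0 s); apply: cvgM; first exact: cvg_cst.
exact: cvg_harmonic.
Qed.

Let shift_in (s b : R) : Theta b -> \forall k \near \oo, Theta (b + s * k.+1%:R^-1).
Proof. by move=> Tb; apply: (cvg_shift s); exact: open_nbhs_nbhs. Qed.

(* With [M a b = P_b(Z <= eta a)], symmetric, and [L a b = P_b(Z < eta a)],
   continuous in [b], and for [eta] increasing, [M a b = M b a <= L b' a] and
   [L b' (a - e) <= M (a - e) b' <= L a b'] if [b < b'] and [0 < e]; now let
   [e] and then [b' - b] tend to [0]. *)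
Lemma symmetric_atomless theta x : Theta theta -> P theta (Z @^-1` [set x]) = 0%E.
Proof.
move=> Tb.
have mx : measurable (Z @^-1` [set x]).
  by rewrite -[X in measurable X]setTI; exact: measurable_funPT.
have [Ox|Ox] := pselect (Omega x); last first.
  have [N [mN N0 NO]] := ZOmega Tb.
  apply/eqP; rewrite eq_le measure_ge0 andbT -N0; apply: le_measure; rewrite ?inE//.
  by move=> w /= Zx; apply: contrapT => /NO; rewrite Zx.
have [a Ta ax] := Omega_eta Ox; rewrite -{}ax in mx *.
have [s s1 hs] := eta_sign.
have ss : s * s = 1 by case: s1 => ->; lra.
have swap b' : Theta b' -> L b' a <= L a b'.
  move=> Tb'.
  have h := cvgL Tb' Ta (@cvg_shift (- s) a).
  rewrite -(cvg_lim _ h)//; apply: limr_le; first exact: cvgP h.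
  near=> k.
  have Tk : Theta (a + - s * k.+1%:R^-1) by near: k; exact: shift_in.
  rewrite -lee_fin -!LE.
  apply: (@le_trans _ _ (P (a + - s * k.+1%:R^-1) [set w | (Z w <= eta b')%R])).
    by apply: le_measure; rewrite ?inE// => w /= /ltW.
  rewrite cdf_sym//; apply: le_measure; rewrite ?inE// => w /= /le_lt_trans; apply.
  apply: hs => //; rewrite opprD addrA subrr sub0r mulNr opprK mulrA ss mul1r.
  by rewrite invr_gt0.
have ML : (P theta [set w | (Z w <= eta a)%R] <= (L a theta)%:E)%E.
  have h := cvgL Ta Tb (@cvg_shift s theta).
  rewrite -[leLHS]fineK ?fin_num_measure// lee_fin.
  rewrite -(cvg_lim _ h)//; apply: limr_ge; first exact: cvgP h.
  near=> k.
  have Tk : Theta (theta + s * k.+1%:R^-1) by near: k; exact: shift_in.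
  apply: le_trans (swap _ Tk).
  rewrite -lee_fin -LE fineK ?fin_num_measure// cdf_sym//.
  apply: le_measure; rewrite ?inE// => w /= /le_lt_trans; apply.
  by apply: hs => //; rewrite addrAC subrr add0r mulrA ss mul1r invr_gt0.
have e : P theta [set w | (Z w <= eta a)%R] =
    (P theta [set w | (Z w < eta a)%R] + P theta (Z @^-1` [set eta a]))%E.
  have -> : [set w | (Z w <= eta a)%R] = [set w | (Z w < eta a)%R] `|` Z @^-1` [set eta a].
    apply/seteqP; split => w /=; first by rewrite le_eqVlt => /orP[/eqP|]; [right|left].
    by move=> [/ltW//|->].
  apply: measureU => //; apply/seteqP; split => w //= [] /[swap] ->.
  by rewrite ltxx.
have h0 : (0 <= P theta (Z @^-1` [set eta a]))%E by [].
move: ML h0; rewrite e LE -[X in (_ + X)%E]fineK ?fin_num_measure//.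
rewrite -[X in (0 <= X)%E]fineK ?fin_num_measure//.
rewrite -[X in _ -> _ -> X = _]fineK ?fin_num_measure//.
rewrite -EFinD !lee_fin => h1 h2; congr EFin; lra.
Unshelve. all: by end_near. Qed.

Lemma symmetric_ltE theta x : Theta theta ->
  P theta [set w | (Z w < x)%R] = P theta [set w | (Z w <= x)%R].
Proof.
move=> Tb.
have mx : measurable (Z @^-1` [set x]).
  by rewrite -[X in measurable X]setTI; exact: measurable_funPT.
have -> : [set w | (Z w <= x)%R] = [set w | (Z w < x)%R] `|` Z @^-1` [set x].
  apply/seteqP; split => w /=; first by rewrite le_eqVlt => /orP[/eqP|]; [right|left].
  by move=> [/ltW//|->].
transitivity (P theta [set w | (Z w < x)%R] + P theta (Z @^-1` [set x]))%E.
  by rewrite symmetric_atomless// adde0.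
apply/esym; apply: measureU => //.
by apply/seteqP; split => w //= [] /[swap] ->; rewrite ltxx.
Qed.

(* The roles of observation and parameter are exchanged: the tail probability
   at [eta a], as a function of [theta], is that of [Z] under [P a]. *)
Lemma tail_prob_sym a theta : Theta a -> Theta theta ->
  tail_prob P Z (eta a) theta = 1 - fine (P a [set w | (Z w <= eta theta)%R]).
Proof. by move=> Ta Tt; rewrite tail_probE symmetric_ltE// cdf_sym. Qed.

Hypothesis conf1 : forall t, Omega t ->
  (\int[@lebesgue_measure R]_(theta in Theta) (conf_density P Z t theta)%:E = 1)%E.

Let F a h := fine (P a [set w | (Z w <= h)%R]).

Let F01 a h : 0 <= F a h <= 1.
Proof.
rewrite fine_ge0//= -lee_fin fineK ?fin_num_measure//; exact: probability_le1.
Qed.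

Let F_mono a h k : h <= k -> F a h <= F a k.
Proof.
move=> hk; rewrite -lee_fin !fineK ?fin_num_measure//.
by apply: le_measure; rewrite ?inE// => w /= /le_trans; apply.
Qed.

Let mT : measurable Theta. Proof. exact: open_measurable. Qed.

Lemma measurable_conf_density t : Omega t -> measurable_fun Theta (conf_density P Z t).
Proof.
move=> Ot; apply: measurableT_comp => //; apply: measurable_derive1 => // x Tx.
exact: dtail.
Qed.

Let tail01 a x : Theta a -> Theta x -> 0 <= tail_prob P Z (eta a) x <= 1.
Proof. by move=> Ta Tx; rewrite tail_prob_sym//; have := F01 a (eta x); rewrite /F; lra. Qed.

Lemma conf_density_cdf_nd a x : {in Theta &, {homo eta : y z / y <= z}} ->
  Theta a -> Theta x ->
  (\int[@lebesgue_measure R]_(z in Theta `&` [set z | (z < x)%R])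
     (conf_density P Z (eta a) z)%:E = (F a (eta x))%:E /\
   \int[@lebesgue_measure R]_(z in Theta `&` [set z | (x < z)%R])
     (conf_density P Z (eta a) z)%:E = (1 - F a (eta x))%:E)%E.
Proof.
move=> nd Ta Tx; have Oa := eta_Omega Ta.
have [] := @conf_cdf_nonincreasing _ _ oTheta (tail_prob P Z (eta a)) x _ _ _ _ Tx.
- by move=> z Tz; exact: dtail.
- by move=> z Tz; exact: tail01.
- move=> y z /set_mem Ty /set_mem Tz yz; rewrite !tail_prob_sym// lerD2l lerN2.
  by apply: F_mono; apply: nd; rewrite ?inE.
- exact: conf1.
move=> h1 h2; split.
  by apply: (etrans h1); rewrite tail_prob_sym//; congr EFin; rewrite /F; lra.
by apply: (etrans h2); rewrite tail_prob_sym.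
Qed.

Lemma conf_density_cdf_ni a x : {in Theta &, {homo eta : y z /~ y <= z}} ->
  Theta a -> Theta x ->
  (\int[@lebesgue_measure R]_(z in Theta `&` [set z | (z < x)%R])
     (conf_density P Z (eta a) z)%:E = (1 - F a (eta x))%:E /\
   \int[@lebesgue_measure R]_(z in Theta `&` [set z | (x < z)%R])
     (conf_density P Z (eta a) z)%:E = (F a (eta x))%:E)%E.
Proof.
move=> ni Ta Tx; have Oa := eta_Omega Ta.
have [] := @conf_cdf_nondecreasing _ _ oTheta (tail_prob P Z (eta a)) x _ _ _ _ Tx.
- by move=> z Tz; exact: dtail.
- by move=> z Tz; exact: tail01.
- move=> y z /set_mem Ty /set_mem Tz yz; rewrite !tail_prob_sym// lerD2l lerN2.
  by apply: F_mono; apply: ni; rewrite ?inE.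
- exact: conf1.
move=> h1 h2; split.
  by apply: (etrans h1); rewrite tail_prob_sym.
by apply: (etrans h2); rewrite tail_prob_sym//; congr EFin; rewrite /F; lra.
Qed.

Lemma conf_density_upper a x : Theta a -> Theta x ->
  (\int[@lebesgue_measure R]_(z in Theta `&` [set z | (eta x < eta z)%R])
     (conf_density P Z (eta a) z)%:E = P a [set w | (eta x < Z w)%R])%E.
Proof.
move=> Ta Tx.
have -> : P a [set w | (eta x < Z w)%R] = (1 - F a (eta x))%:E.
  have -> : [set w | (eta x < Z w)%R] = ~` [set w | (Z w <= eta x)%R].
    by apply/seteqP; split => w /=; [rewrite ltNge => /negP|move/negP; rewrite -ltNge].
  by rewrite probability_setC// EFinB fineK// fin_num_measure.
case: mono_eta => mono.
  rewrite -(conf_density_cdf_nd mono Ta Tx).2; congr (integral _ _ _).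
  apply/seteqP; split => z [Tz /= xz]; split => //=; rewrite ltNge; apply/negP => h.
    by move: xz; rewrite ltNge => /negP; apply; apply: mono; rewrite ?inE.
  have := mono _ _ (mem_set Tx) (mem_set Tz) (ltW xz).
  move=> h'; have e : eta x = eta z by apply/eqP; rewrite eq_le h h'.
  case: bij_eta => _ inj _; move: xz; rewrite (inj _ _ _ _ e) ?inE//.
  by rewrite ltxx.
rewrite -(conf_density_cdf_ni mono Ta Tx).1; congr (integral _ _ _).
apply/seteqP; split => z [Tz /= xz]; split => //=; rewrite ltNge; apply/negP => h.
  by move: xz; rewrite ltNge => /negP; apply; apply: mono; rewrite ?inE.
have := mono _ _ (mem_set Tx) (mem_set Tz) (ltW xz).
move=> h'; have e : eta x = eta z by apply/eqP; rewrite eq_le h h'.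
case: bij_eta => _ inj _; move: xz; rewrite (inj _ _ _ _ e) ?inE//.
by rewrite ltxx.
Qed.

(* Under the confidence density given [t = eta a], [eta theta] is distributed
   as [Z] under [P a]. *)
Lemma conf_density_transfer d' (W' : measurableType d') (Q : probability W' R)
    (V : {mfun W' >-> R}) (N : set W') a : Theta a ->
  measurable N -> Q N = 0%E -> (forall v, ~ N v -> Omega (V v)) ->
  (\int[@lebesgue_measure R]_(theta in Theta)
     ((conf_density P Z (eta a) theta)%:E * Q [set v | (V v < eta theta)%R]) =
   \int[P a]_w Q [set v | (V v < Z w)%R])%E.
Proof.
move=> Ta mN N0 NO; have Oa := eta_Omega Ta.
pose c := conf_density P Z (eta a) \_ Theta.
pose e := eta \_ Theta.
have mc : measurable_fun setT c.
  by apply/(measurable_restrictT _ mT); exact: measurable_conf_density.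
have me : measurable_fun setT e.
  by apply/(measurable_restrictT _ mT); exact: monotone_on_measurable.
have c0 z : 0 <= c z.
  by rewrite /c patchE; case: ifPn => // _; exact: normr_ge0.
pose S := [set p : R * W' | V p.2 < e p.1].
have mV2 d1 (T : measurableType d1) : measurable_fun setT (fun p : T * W' => V p.2).
  exact: (measurableT_comp (@measurable_funPT _ _ _ _ V)).
have mS : measurable S.
  by apply: measurable_lt_set; [exact: mV2|exact: (measurableT_comp me)].
have mVlt x : measurable [set v | V v < x] by exact: measurable_lt_set.
pose f (p : R * W') : \bar R := (c p.1 * \1_S p)%:E.
have mf : measurable_fun setT f.
  apply/measurable_EFinP; apply: measurable_funM; first exact: (measurableT_comp mc).
  exact: measurable_indic.
have f0 p : (0 <= f p)%E by rewrite lee_fin mulr_ge0// indicE.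
transitivity (\int[@lebesgue_measure R]_theta \int[Q]_v f (theta, v))%E.
  rewrite integral_mkcond; apply: eq_integral => theta _; rewrite patchE /f /=.
  case: ifPn => [Tt|Tt]; last first.
    by rewrite integral0_eq// => z _; rewrite /c patchE (negbTE Tt) mul0r.
  transitivity (\int[Q]_v ((c theta)%:E * (\1_[set v | (V v < eta theta)%R] v)%:E))%E.
    rewrite ge0_integralZl//; last 2 first.
    - by apply/measurable_EFinP; exact: measurable_indic.
    - by rewrite lee_fin.
    by rewrite integral_indic// setIT /c patchE Tt.
  apply: eq_integral => z _; rewrite EFinM; congr (_ * _%:E)%E.
  rewrite !indicE; congr (_%:R); congr nat_of_bool; apply/idP/idP; rewrite !inE /S /e /=.
    by rewrite patchE Tt.
  by rewrite patchE Tt.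
transitivity (\int[Q]_v \int[@lebesgue_measure R]_theta f (theta, v))%E.
  exact: (@fubini_tonelli _ _ _ _ _ (@lebesgue_measure R) Q f mf f0).
pose S' := [set p : W' * W | V p.1 < Z p.2].
have mS' : measurable S'.
  apply: measurable_lt_set; first exact: (measurableT_comp (@measurable_funPT _ _ _ _ V)).
  exact: (measurableT_comp (@measurable_funPT _ _ _ _ Z)).
transitivity (\int[Q]_v P a (xsection S' v))%E; last first.
  rewrite (integral_xsection_ysection Q (P a) mS').
  apply: eq_integral => w _; congr (Q _).
  by apply/seteqP; split => z; rewrite /ysection /S' /= inE.
apply: ge0_ae_eq_integral => //.
- exact: (@measurable_fun_fubini_tonelli_G _ _ _ _ _ (@lebesgue_measure R) f mf f0).
- exact: (measurable_fun_xsection (P a) mS').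
- by move=> z _; exact: integral_ge0.
exists N; split => // v /= h; apply: contrapT => Nv; apply: h => _.
have [x Tx xv] := Omega_eta (NO _ Nv).
have -> : xsection S' v = [set w | (eta x < Z w)%R].
  by apply/seteqP; split => w; rewrite /xsection /S' /= inE xv.
rewrite -conf_density_upper// [RHS]integral_mkcond; apply: eq_integral => y _.
rewrite /f patchE /= /c /e /S indicE.
have [Ty|Ty] := boolP (y \in Theta); last first.
  rewrite patchE (negbTE Ty) mul0r; case: ifPn => // /set_mem[/mem_set].
  by rewrite (negbTE Ty).
rewrite patchE Ty; have [h|h] := boolP (V v < eta y).
  rewrite mem_set/=; last by rewrite /e patchE Ty.
  by rewrite mulr1 mem_set//; split; [exact: set_mem|rewrite /= xv].
rewrite memNset ?mulr0 ?memNset//=; first by move=> [_]; rewrite xv; exact/negP.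
by rewrite /= /e patchE Ty; exact/negP.
Qed.

Lemma cdf_uniform theta b : Theta theta -> 0 < b < 1 ->
  P theta [set w | F theta (Z w) <= b] = b%:E.
Proof.
move=> Tt b01.
have nu1 x : distribution (P theta) Z [set x] = 0%E by exact: symmetric_atomless.
rewrite -[RHS](atomless_uniform nu1 b01) /=; congr (P theta _).
apply/seteqP; split => w /=; rewrite -lee_fin fineK ?fin_num_measure//.
Qed.

Lemma confidence_coverage (alpha : R) (CI : R -> set R) theta0 : 0 < alpha < 1 ->
  (forall t, Omega t -> [/\ CI t `<=` Theta, is_interval (CI t) &
    (\int[@lebesgue_measure R]_(theta in CI t) (conf_density P Z t theta)%:E =
     (1 - alpha)%:E)%E]) ->
  (forall t t', Omega t -> Omega t' ->
    (\int[@lebesgue_measure R]_(theta in Theta `&` left_of (CI t))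
        (conf_density P Z t theta)%:E =
     \int[@lebesgue_measure R]_(theta in Theta `&` left_of (CI t'))
        (conf_density P Z t' theta)%:E)%E) ->
  Theta theta0 -> measurable [set w | CI (Z w) theta0] ->
  P theta0 [set w | CI (Z w) theta0] = (1 - alpha)%:E.
Proof.
move=> /andP[a0 a1] hCI htail T0 mE; have O0 := eta_Omega T0.
pose c t x := (conf_density P Z t x)%:E.
pose p := (\int[@lebesgue_measure R]_(theta in Theta `&` left_of (CI (eta theta0)))
        c (eta theta0) theta)%E.
have hp t : Omega t ->
  (\int[@lebesgue_measure R]_(theta in Theta `&` left_of (CI t)) c t theta = p)%E.
  by move=> Ot; exact: htail.
have mc t : Omega t -> measurable_fun Theta (c t).
  by move=> Ot; apply/measurable_EFinP; exact: measurable_conf_density.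
have c0 t x : (0 <= c t x)%E by rewrite lee_fin normr_ge0.
have [pr pE pr01] : exists2 r, p = r%:E & 0 <= r <= alpha.
  have [s i m] := hCI _ O0.
  have := interval_mass_le mT (mc _ O0) (fun u _ => c0 _ u) s i (hp _ O0) m.
  rewrite /c conf1// => p1.
  have p0 : (0 <= p)%E by apply: integral_ge0 => x _; exact: c0.
  have pfin : p \is a fin_num.
    rewrite ge0_fin_numE//; apply: le_lt_trans (ltry 1); apply: le_trans p1.
    by rewrite leeDl// lee_fin; lra.
  exists (fine p); first by rewrite fineK.
  rewrite -(fineK pfin) in p0 p1.
  by move: p0 p1; rewrite -EFinD !lee_fin => -> /=; lra.
have [N [mN N0 NO]] := ZOmega T0.
pose C t := (\int[@lebesgue_measure R]_(z in Theta `&` [set z | (z < theta0)%R]) c t z)%E.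
have inC t : Omega t -> CI t theta0 -> (p <= C t)%E /\ (C t <= p + (1 - alpha)%:E)%E.
  move=> Ot; have [s i m] := hCI _ Ot.
  exact: (interval_mass_in mT (mc _ Ot) (fun u _ => c0 _ u) s i (hp _ Ot) m).
have memC t : Omega t -> (p < C t)%E -> (C t < p + (1 - alpha)%:E)%E -> CI t theta0.
  move=> Ot; have [s i m] := hCI _ Ot.
  exact: (interval_mass_mem mT (mc _ Ot) (fun u _ => c0 _ u) s i (hp _ Ot) m).
have Fsym a : Theta a -> F a (eta theta0) = F theta0 (eta a).
  by move=> Ta; rewrite /F cdf_sym.
have hF b : 0 < b < 1 -> exists G, [/\ measurable G, P theta0 G = b%:E &
    forall w, ~ N w -> G w <-> F theta0 (Z w) <= b].
  move=> b01; exists [set w | F theta0 (Z w) <= b]; split => //; last exact: cdf_uniform.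
  apply: measurable_le_set => //; apply: measurableT_comp => //.
  by apply: nondecreasing_measurable => // x y xy; exact: F_mono.
rewrite pE in inC memC.
case: mono_eta => mono.
  have CE t : Omega t -> C t = (F theta0 t)%:E.
    move=> Ot; have [a Ta <-] := Omega_eta Ot.
    by rewrite -(Fsym _ Ta) -(conf_density_cdf_nd mono Ta T0).1.
  have -> : 1 - alpha = (pr + (1 - alpha)) - pr by lra.
  apply: (coverage_squeeze (V := fun w => F theta0 (Z w)) mN N0 hF mE); [lra|lra|lra| |].
    move=> w /NO Ow h; apply: memC => //; rewrite CE// -?EFinD lte_fin; lra.
  by move=> w /NO Ow /(inC _ Ow); rewrite CE// -EFinD !lee_fin => -[-> ->].
have CE t : Omega t -> C t = (1 - F theta0 t)%:E.
  move=> Ot; have [a Ta <-] := Omega_eta Ot.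
  by rewrite -(Fsym _ Ta) -(conf_density_cdf_ni mono Ta T0).1.
have -> : 1 - alpha = (1 - pr) - (alpha - pr) by lra.
apply: (coverage_squeeze (V := fun w => F theta0 (Z w)) mN N0 hF mE); [lra|lra|lra| |].
  move=> w /NO Ow h; apply: memC => //; rewrite CE// -?EFinD lte_fin; lra.
move=> w /NO Ow /(inC _ Ow); rewrite CE// -EFinD !lee_fin; lra.
Qed.

End symmetric_statistic.

(** * Prediction *)

Lemma measure_eq_outside_null d (W : measurableType d) (R : realType)
    (P : probability W R) (N A B : set W) :
  measurable N -> P N = 0%E -> measurable A -> measurable B ->
  (forall w, ~ N w -> A w <-> B w) -> P A = P B.
Proof.
move=> mN N0 mA mB AB.
have le (C D : set W) : measurable C -> measurable D ->
    (forall w, ~ N w -> C w -> D w) -> (P C <= P D)%E.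
  move=> mC mD CD; rewrite -[leRHS]adde0 -N0.
  apply: (@le_trans _ _ (P (D `|` N))); last exact: measureU2.
  apply: le_measure; rewrite ?inE//; first exact: measurableU.
  by move=> w Cw; have [Nw|Nw] := pselect (N w); [right|left; exact: CD].
by apply/eqP; rewrite eq_le !le// => w Nw /AB; exact.
Qed.

Definition pred_density_at d (W : measurableType d) (R : realType)
    (Theta : set R) (P : R -> probability W R) (Z : {mfun W >-> R})
    (f : R -> R -> R) (t u : R) : \bar R :=
  (\int[@lebesgue_measure R]_(theta in Theta)
     (conf_density P Z t theta * f theta u)%:E)%E.

Section prediction.
Context (R : realType) d (W : measurableType d).
Variables (Theta : set R) (P : R -> probability W R) (Z : {mfun W >-> R})
  (Omega : set R) (eta : R -> R).
Hypotheses (oTheta : open Theta) (bij_eta : set_bij Theta Omega eta)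
  (mono_eta : monotone_on Theta eta).
Hypothesis ZOmega : forall theta, Theta theta ->
  exists N, [/\ measurable N, P theta N = 0%E & forall w, ~ N w -> Omega (Z w)].
Hypothesis symF : forall t h, Omega t -> Omega h ->
  cdf_eta Theta P eta Z t h = cdf_eta Theta P eta Z h t.
Hypothesis dtail : forall t theta, Omega t -> Theta theta ->
  derivable (tail_prob P Z t) theta 1.
Hypothesis conf1 : forall t, Omega t ->
  (\int[@lebesgue_measure R]_(theta in Theta) (conf_density P Z t theta)%:E = 1)%E.
Variables (U : {mfun W >-> R}) (f : R -> R -> R) (Omega_u : set R).
Hypotheses (iOu : is_interval Omega_u)
  (dens : forall theta, Theta theta -> has_density_on (P theta) U (f theta) Omega_u)
  (mf : measurable_fun (Theta `*` [set: R]) (fun p : R * R => f p.1 p.2))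
  (indep : forall theta A B, Theta theta -> measurable A -> measurable B ->
    (P theta (Z @^-1` A `&` U @^-1` B) =
     P theta (Z @^-1` A) * P theta (U @^-1` B))%E).
Variable T1 : {mfun R >-> R}.
Hypotheses (rT1 : T1 @` Omega_u `<=` Omega) (injT1 : set_inj Omega_u T1)
  (monoT1 : monotone_on Omega_u T1).

Local Notation g := (pred_density_at Theta P Z f).
Variable q : R -> R -> R.
Hypothesis qE : forall a t, 0 < a < 1 -> Omega t -> q a t = quantile (g t) a.
Let c t theta := conf_density P Z t theta.
Let muU theta := distribution (P theta) (U : {RV P theta >-> R}).

Let mT : measurable Theta. Proof. exact: open_measurable. Qed.

Let mc t : Omega t -> measurable_fun Theta (c t).
Proof. exact: measurable_conf_density. Qed.

Let c0 t theta : 0 <= c t theta. Proof. exact: normr_ge0. Qed.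

Let f0 theta u : Theta theta -> 0 <= f theta u.
Proof. by case/dens. Qed.

Let fD theta u : Theta theta -> (0 < (f theta u)%:E)%E <-> Omega_u u.
Proof. by rewrite lte_fin => /dens[]. Qed.

Let mftheta theta : Theta theta -> measurable_fun setT (f theta).
Proof.
move=> Tt; apply: (@measurable_comp _ _ _ _ _ _ (Theta `*` [set: R])
  (fun p : R * R => f p.1 p.2) setT (fun u => (theta, u))) => //.
- exact: measurableX.
- by move=> _ [u _ <-].
- exact: measurable_fun_pair.
Qed.

Let muUE theta A : Theta theta -> measurable A ->
  muU theta A = (\int[@lebesgue_measure R]_(u in A) (f theta u)%:E)%E.
Proof. by move=> Tt mA; case: (dens Tt) => _ _; apply. Qed.

Let mcf t : Omega t -> measurable_fun (Theta `*` [set: R] : set (R * R))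
  (fun p : R * R => (c t p.1 * f p.1 p.2)%:E).
Proof.
move=> Ot; apply/measurable_EFinP; apply: measurable_funM => //.
apply: (@measurable_comp _ _ _ _ _ _ Theta (c t) _ fst) => //.
- by move=> _ [[x y] [Tx _] <-].
- exact: mc.
- by apply: measurable_funTS; exact: measurable_fst.
Qed.

Let mg t : Omega t -> measurable_fun setT (g t).
Proof.
move=> Ot; apply: (measurable_fubini_in (@lebesgue_measure R) mT measurableT (mcf Ot)).
by move=> [x y] [/= Tx _]; rewrite lee_fin mulr_ge0 ?f0.
Qed.

Let g0 t u : (0 <= g t u)%E.
Proof. by apply: integral_ge0 => x Tx; rewrite lee_fin mulr_ge0 ?f0. Qed.

Let gE t A : Omega t -> measurable A ->
  (\int[@lebesgue_measure R]_(u in A) g t u =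
   \int[@lebesgue_measure R]_(theta in Theta) ((c t theta)%:E * muU theta A))%E.
Proof.
move=> Ot mA.
have mcfA : measurable_fun (Theta `*` A : set (R * R))
    (fun p : R * R => (c t p.1 * f p.1 p.2)%:E).
  by apply: measurable_funS (mcf Ot) => //; [exact: measurableX|move=> [x y] []].
rewrite /pred_density_at.
rewrite -(fubini_tonelli_in (@lebesgue_measure R) (@lebesgue_measure R) mT mA mcfA);
  last first.
  by move=> [x y] [/= Tx _]; rewrite lee_fin mulr_ge0 ?f0.
apply: eq_integral => theta /set_mem Tt; rewrite muUE//=.
under eq_integral do rewrite EFinM.
rewrite ge0_integralZl//.
- by apply/measurable_EFinP; apply: measurable_funTS; exact: mftheta.
- by move=> u _; rewrite lee_fin f0.
- by rewrite lee_fin.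
Qed.

Let g1 t : Omega t -> (\int[@lebesgue_measure R]_u g t u = 1)%E.
Proof.
move=> Ot; rewrite gE// -[RHS](conf1 Ot); apply: eq_integral => theta _.
have -> : muU theta [set: R] = 1%E by exact: probability_setT.
by rewrite mule1.
Qed.

Let gD t u : Omega t -> (0 < g t u)%E <-> Omega_u u.
Proof.
move=> Ot; split.
  apply: contraPP => Ou; rewrite /pred_density_at integral0_eq ?ltxx// => theta Tt.
  suff -> : f theta u = 0 by rewrite mulr0.
  apply/eqP; rewrite eq_le f0// andbT leNgt; apply/negP => h.
  by apply: Ou; apply/(fD u Tt); rewrite lte_fin.
move=> Ou; rewrite lt_neqAle g0 andbT; apply/eqP => e.
have mcu : measurable_fun Theta (fun theta => (c t theta * f theta u)%:E).
  apply/measurable_EFinP; apply: measurable_funM; first exact: mc.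
  apply: (@measurable_comp _ _ _ _ _ _ (Theta `*` [set: R])
    (fun p : R * R => f p.1 p.2) Theta (fun x => (x, u))) => //.
  - exact: measurableX.
  - by move=> _ [x Tx <-].
  - by apply: measurable_funTS; exact: pair2_measurable.
have mct : measurable_fun Theta (fun theta => (c t theta)%:E).
  by apply/measurable_EFinP; exact: mc.
have : ae_eq (@lebesgue_measure R) Theta (fun theta => (c t theta * f theta u)%:E) (cst 0%E).
  apply: (ae_eq_integral_abs (@lebesgue_measure R) mT mcu).1.
  rewrite [RHS]e; apply: eq_integral => x /set_mem Tx.
  by rewrite gee0_abs// lee_fin mulr_ge0 ?f0.
move=> [N [mN N0 subN]].
have : ae_eq (@lebesgue_measure R) Theta (fun theta => (c t theta)%:E) (cst 0%E).
  exists N; split => // x /= h; apply: subN => /= h'; apply: h => Tx.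
  have [/eqP] := h' Tx; rewrite mulf_eq0 => /orP[/eqP -> //|/eqP fx0].
  by have := (fD u Tx).2 Ou; rewrite fx0 ltxx.
move/(ae_eq_integral_abs (@lebesgue_measure R) mT mct).2.
have := conf1 Ot; under [X in X = 0%E -> _]eq_integral do rewrite gee0_abs ?lee_fin//.
by move=> ->; move/eqP; rewrite onee_eq0.
Qed.

Let piE t : Omega t -> exists nu : probability R R, forall A, measurable A ->
  nu A = (\int[@lebesgue_measure R]_(u in A) g t u)%E.
Proof.
move=> Ot; have [nu nuE] := density_probability (mg Ot) (g0 t) (g1 Ot).
by exists nu => A _; exact: nuE.
Qed.

Let C t x := (\int[@lebesgue_measure R]_(u in `]-oo, x]) g t u)%E.

Let muUN theta : Theta theta -> muU theta (~` Omega_u) = 0%E.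
Proof.
move=> Tt; apply: (density_support iOu _ (fun u => fD u Tt)).
- by move=> u; rewrite lee_fin f0.
- by move=> A mA; exact: muUE.
Qed.

Let muU1 theta x : Theta theta -> muU theta [set x] = 0%E.
Proof.
move=> Tt; apply: (density_atomless (g := EFin \o f theta)).
- by apply/measurable_EFinP; exact: mftheta.
- by move=> A mA; exact: muUE.
Qed.

Let H_lt theta x y : Theta theta -> Omega_u x -> Omega_u y -> x < y ->
  (muU theta `]-oo, x]%classic < muU theta `]-oo, y]%classic)%E.
Proof.
move=> Tt; apply: (density_cdf_lt iOu _ _ (fun u => fD u Tt)).
- by apply/measurable_EFinP; exact: mftheta.
- by move=> u; rewrite lee_fin f0.
- by move=> A mA; exact: muUE.
Qed.

Let qP a t : 0 < a < 1 -> Omega t -> [/\ Omega_u (q a t), C t (q a t) = a%:E &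
  forall u, Omega_u u -> (C t u <= a%:E)%E <-> u <= q a t].
Proof.
move=> a01 Ot; have [nu nuE] := piE Ot.
have [h1 h2 h3] := density_quantile iOu (mg Ot) (g0 t) (fun u => gD u Ot) nuE a01.
rewrite qE//; split => //; first by rewrite /C -nuE.
by move=> u Ou; rewrite /C -nuE//; exact: h3.
Qed.

Let C_lt t x y : Omega t -> Omega_u x -> Omega_u y -> x < y -> (C t x < C t y)%E.
Proof.
move=> Ot; have [nu nuE] := piE Ot; rewrite /C -!nuE//.
exact: (density_cdf_lt iOu (mg Ot) (g0 t) (fun u => gD u Ot) nuE).
Qed.

Let C_inj t x y : Omega t -> Omega_u x -> Omega_u y -> C t x = C t y -> x = y.
Proof.
move=> Ot Ox Oy e; have [xy|yx|//] := ltgtP x y.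
  by have := C_lt Ot Ox Oy xy; rewrite e ltxx.
by have := C_lt Ot Oy Ox yx; rewrite e ltxx.
Qed.

Let C_between t x : Omega t -> (0 < C t x < 1)%E ->
  (exists2 y, Omega_u y & y < x) /\ (exists2 y, Omega_u y & x < y).
Proof.
move=> Ot; have [nu nuE] := piE Ot; rewrite /C -!nuE// => /andP[].
exact: (density_between iOu (mg Ot) (g0 t) (fun u => gD u Ot) nuE).
Qed.

Let C01 t x : Omega t -> (0 <= C t x <= 1)%E.
Proof.
by move=> Ot; have [nu nuE] := piE Ot; rewrite /C -!nuE// measure_ge0 probability_le1.
Qed.

(* Thus the hypothesis [F1sym] below, at [t = h], implies that [F1] is itself
   symmetric. *)
Let q_onto a t t' : 0 < a < 1 -> Omega t -> Omega t' ->
  exists2 b, 0 < b < 1 & q b t' = q a t.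
Proof.
move=> a01 Ot Ot'; have [Oq Cq _] := qP a01 Ot.
have [] := @C_between t (q a t) Ot; first by rewrite Cq !lte_fin.
move=> [y Oy yq] [y' Oy' qy'].
have b0 : (0 < C t' (q a t))%E.
  by apply: le_lt_trans (C_lt Ot' Oy Oq yq); have /andP[] := C01 y Ot'.
have b1 : (C t' (q a t) < 1)%E.
  by apply: lt_le_trans (C_lt Ot' Oq Oy' qy') _; have /andP[] := C01 y' Ot'.
have bfin : C t' (q a t) \is a fin_num.
  by rewrite ge0_fin_numE ?(lt_trans b1) ?ltry// ltW.
have [b bE] : exists b, C t' (q a t) = b%:E.
  by exists (fine (C t' (q a t))); rewrite fineK.
rewrite bE !lte_fin in b0 b1.
have b01 : 0 < b < 1 by rewrite b0 b1.
have [Oq' Cq' hq'] := qP b01 Ot'.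
exists b; first exact: b01.
exact: (C_inj Ot' Oq' Oq (etrans Cq' (esym bE))).
Qed.

Let N_UZ theta : Theta theta -> exists N, [/\ measurable N, P theta N = 0%E &
  forall w, ~ N w -> Omega (Z w) /\ Omega_u (U w)].
Proof.
move=> Tt; have [N [mN N0 NO]] := ZOmega Tt.
have mO : measurable (U @^-1` (~` Omega_u)).
  rewrite -[X in measurable X]setTI; apply: measurable_funPT => //.
  by apply: measurableC; exact: is_interval_measurable.
exists (N `|` U @^-1` (~` Omega_u)); split.
- exact: measurableU.
- apply/eqP; rewrite eq_le measure_ge0 andbT.
  apply: (@le_trans _ _ (P theta N + P theta (U @^-1` (~` Omega_u)))%E).
    exact: measureU2.
  have -> : P theta (U @^-1` (~` Omega_u)) = 0%E by exact: muUN.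
  by rewrite N0 adde0.
- by move=> w /= /not_orP[/NO Ow /contrapT].
Qed.

Let H theta x := fine (muU theta `]-oo, x]%classic).

Let HE theta x : muU theta `]-oo, x]%classic = (H theta x)%:E.
Proof. by rewrite fineK// fin_num_measure. Qed.

Let H_mono theta x y : x <= y -> H theta x <= H theta y.
Proof. by move=> xy; rewrite -lee_fin -!HE; exact: cdf_mono. Qed.

(* [H theta0 (U w)] is uniform and independent of [Z]. *)
Let pivot_uniform theta0 a (psi : R -> R) : Theta theta0 -> 0 < a < 1 ->
  measurable_fun setT psi -> (forall t, 0 <= psi t <= 1) ->
  (forall t, Omega t -> H theta0 (q a t) = psi t) ->
  (\int[P theta0]_w (psi (Z w))%:E = a%:E)%E ->
  exists F, [/\ measurable F, P theta0 F = a%:E &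
    forall w, Omega (Z w) -> Omega_u (U w) -> F w <-> (C (Z w) (U w) <= a%:E)%E].
Proof.
move=> T0 a01 mpsi psi01 Hq Epsi.
have mH : measurable_fun setT (H theta0).
  by apply: nondecreasing_measurable => // x y; exact: H_mono.
pose S := [set p : R * R | H theta0 p.2 <= psi p.1].
have mS : measurable S.
  by apply: measurable_le_set; [exact: (measurableT_comp mH)|exact: (measurableT_comp mpsi)].
exists [set w | S (Z w, U w)]; split.
- apply: measurable_le_set; first exact: (measurableT_comp mH).
  exact: (measurableT_comp mpsi).
- rewrite (independent_joint (fun A B => @indep theta0 A B T0) mS).
  rewrite -Epsi -(@ge0_integral_distribution _ _ _ _ _ (P theta0) Z (EFin \o psi)); last 2 first.
  + by apply/measurable_EFinP.
  + by move=> t; rewrite lee_fin; have /andP[] := psi01 t.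
  apply: eq_integral => t _ /=.
  rewrite -[RHS](atomless_uniform_closed (mu := muU theta0) _ (psi01 t)); last first.
    by move=> x; exact: muU1.
  have h u : (muU theta0 `]-oo, u]%classic <= (psi t)%:E)%E = (H theta0 u <= psi t).
    by rewrite HE lee_fin.
  have -> : [set u | (muU theta0 `]-oo, u]%classic <= (psi t)%:E)%E] = xsection S t.
    by apply/funext => u; rewrite /mkset h /xsection /S /= in_setE.
  by [].
- move=> w OZ OU; have [Oq _ hq] := qP a01 OZ.
  apply: iff_trans (iff_sym (hq _ OU)); rewrite /S /= -Hq//.
  split; last exact: H_mono.
  move=> h; rewrite leNgt; apply/negP => /(H_lt T0 Oq OU).
  by rewrite !HE lte_fin ltNge h.
Qed.

Hypothesis F1sym : forall a t h, 0 < a < 1 -> Omega t -> Omega h ->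
  cdf_eta Theta P eta (T1 \o U) (T1 (q a t)) h =
  cdf_eta Theta P eta (T1 \o U) t (T1 (q a h)).

Let Oeta theta : Theta theta -> Omega (eta theta).
Proof. exact: (eta_Omega bij_eta). Qed.

Let OT1 u : Omega_u u -> Omega (T1 u).
Proof. by move=> Ou; apply: rT1; exists u. Qed.

Let mT1U x : measurable [set w | T1 (U w) <= x].
Proof. by apply: measurable_le_set => //; exact: measurableT_comp. Qed.

Let F1E x theta : Theta theta ->
  cdf_eta Theta P eta (T1 \o U) x (eta theta) = P theta [set w | T1 (U w) <= x].
Proof. by move=> Tt; rewrite (cdf_etaE P bij_eta). Qed.

Section exchange.
Variable K : R -> set R.
Hypotheses (mK : forall x, measurable (K x))
  (KE : forall u x, Omega_u u -> Omega_u x -> T1 u <= T1 x <-> K x u).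

Let T1K theta x : Theta theta -> Omega_u x ->
  P theta [set w | T1 (U w) <= T1 x] = muU theta (K x).
Proof.
move=> Tt Ox; have [N [mN N0 NO]] := N_UZ Tt.
apply: (measure_eq_outside_null mN N0) => //.
  by rewrite -[X in measurable X]setTI; exact: measurable_funPT.
by move=> w /NO[_ Ou]; exact: KE.
Qed.

Lemma cdf_exchange theta0 a : Theta theta0 -> 0 < a < 1 ->
  exists phi : R -> R, [/\ measurable_fun setT phi, forall t, 0 <= phi t <= 1,
    forall t, Omega t -> muU theta0 (K (q a t)) = (phi t)%:E &
    (\int[P theta0]_w (phi (Z w))%:E =
     \int[@lebesgue_measure R]_(u in K (q a (eta theta0))) g (eta theta0) u)%E].
Proof.
move=> T0 a01; have O0 := Oeta T0; pose q0 := q a (eta theta0).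
have [Oq0 _ _] := qP a01 O0.
have [theta' T' etaT'] := Omega_eta bij_eta (OT1 Oq0).
pose rho := distribution (P theta') (T1 \o U).
pose phi t := fine (rho `]-oo, t]%classic).
have phiE t : rho `]-oo, t]%classic = (phi t)%:E by rewrite fineK// fin_num_measure.
have phiP t : (phi t)%:E = P theta' [set w | T1 (U w) <= t].
  by rewrite -phiE; congr (P theta' _); apply/seteqP; split => w /=; rewrite in_itv.
have phi_mono s t : s <= t -> phi s <= phi t.
  by move=> st; rewrite -lee_fin -!phiE; exact: cdf_mono.
have mphi : measurable_fun setT phi by exact: nondecreasing_measurable.
exists phi; split => //.
- move=> t; rewrite -!lee_fin -phiE measure_ge0; exact: probability_le1.
- move=> t Ot; have [Oq _ _] := qP a01 Ot.
  by rewrite phiP -(F1E _ T') etaT' -F1sym// F1E// T1K.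
have phi_eta theta : Theta theta -> (phi (eta theta))%:E = muU theta (K q0).
  move=> Tt; have [b b01 bq] := q_onto a01 O0 (Oeta Tt).
  rewrite phiP -(F1E _ T') etaT' -bq -F1sym//; [|exact: Oeta|exact: Oeta].
  by rewrite F1E// bq T1K.
have [N [mN N0 NO]] := N_UZ T'.
have rho1 x : rho [set x] = 0%E.
  have [[u Ou ux]|nx] := pselect (exists2 u, Omega_u u & T1 u = x).
    rewrite -(muU1 u T'); apply: (measure_eq_outside_null mN N0).
    - by rewrite -[X in measurable X]setTI; exact: (measurable_funPT (T1 \o U)).
    - by rewrite -[X in measurable X]setTI; exact: measurable_funPT.
    move=> w /NO[_ Ow] /=; split => [|->//]; rewrite -ux => h.
    by apply: injT1 => //; rewrite inE.
  rewrite -(measure0 (P theta')); apply: (measure_eq_outside_null mN N0) => //.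
  by move=> w /NO[_ Ow] /=; split => // h; apply: nx; exists (U w).
have mlt x : measurable [set w | T1 (U w) < x].
  by apply: measurable_lt_set => //; exact: measurableT_comp.
have phi_lt t : (phi t)%:E = P theta' [set w | (T1 (U w) < t)%R].
  transitivity (rho `]-oo, t[%classic).
    by rewrite -phiE; apply/esym; exact: (atomless_itv rho1).
  by congr (P theta' _); apply/seteqP; split => w /=; rewrite in_itv.
under eq_integral do rewrite phi_lt.
rewrite -(conf_density_transfer oTheta bij_eta mono_eta ZOmega symF dtail conf1
  (V := T1 \o U) T0 mN N0); last by move=> w /NO[_ /OT1].
rewrite gE//; last exact: mK.
apply: eq_integral => theta /set_mem Tt; congr (_ * _)%E.
by rewrite -phi_eta// phi_lt.
Qed.

End exchange.

Let pivot theta0 a : Theta theta0 -> 0 < a < 1 ->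
  exists F, [/\ measurable F, P theta0 F = a%:E &
    forall w, Omega (Z w) -> Omega_u (U w) -> F w <-> (C (Z w) (U w) <= a%:E)%E].
Proof.
move=> T0 a01; have O0 := Oeta T0.
have [Oq0 Cq0 _] := qP a01 O0.
case: monoT1 => mono.
  have KE u x : Omega_u u -> Omega_u x -> T1 u <= T1 x <-> `]-oo, x]%classic u.
    move=> Ou Ox; rewrite /= in_itv/=; split => h; last by apply: mono; rewrite ?inE.
    rewrite leNgt; apply/negP => xu.
    have e : T1 u = T1 x.
      by apply/eqP; rewrite eq_le h /=; apply: mono; rewrite ?inE// ltW.
    by move: xu; rewrite (injT1 _ _ e) ?inE// ltxx.
  have [phi [mphi phi01 h1 h2]] 
    := cdf_exchange (K := fun x => `]-oo, x]%classic) (fun x => measurable_itv _) KE T0 a01.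
  apply: (pivot_uniform T0 a01 mphi phi01) => [t Ot|].
    by apply: EFin_inj; rewrite -h1// HE.
  by rewrite h2 -[RHS]Cq0.
have KE u x : Omega_u u -> Omega_u x -> T1 u <= T1 x <-> `[x, +oo[%classic u.
  move=> Ou Ox; rewrite /= in_itv/= andbT; split => h; last by apply: mono; rewrite ?inE.
  rewrite leNgt; apply/negP => xu.
  have e : T1 u = T1 x.
    by apply/eqP; rewrite eq_le h /=; apply: mono; rewrite ?inE// ltW.
  by move: xu; rewrite (injT1 _ _ e) ?inE// ltxx.
have [phi [mphi phi01 h1 h2]] 
    := cdf_exchange (K := fun x => `[x, +oo[%classic) (fun x => measurable_itv _) KE T0 a01.
have mpsi : measurable_fun setT (fun t => 1 - phi t) by exact: measurable_funB.
apply: (pivot_uniform T0 a01 mpsi) => [t|t Ot|].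
- by have := phi01 t; lra.
- have hy := atomless_itvy (mu := muU theta0) (fun x => muU1 x T0) (q a t).
  have : (1 - muU theta0 `]-oo, q a t]%classic = (phi t)%:E)%E.
    exact: (etrans (esym hy) (h1 t Ot)).
  by rewrite HE -EFinB => -[<-]; lra.
have mphiZ : measurable_fun setT (fun w => (phi (Z w))%:E).
  by apply/measurable_EFinP; exact: measurableT_comp.
have mpsiZ : measurable_fun setT (fun w => (1 - phi (Z w))%:E).
  by apply/measurable_EFinP; exact: (measurableT_comp mpsi).
have sum1 : (\int[P theta0]_w (1 - phi (Z w))%:E + \int[P theta0]_w (phi (Z w))%:E = 1)%E.
  rewrite -ge0_integralD//; last 2 first.
  - by move=> w _; rewrite lee_fin; have := phi01 (Z w); lra.
  - by move=> w _; rewrite lee_fin; have /andP[] := phi01 (Z w).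
  under eq_integral do rewrite -EFinD subrK.
  by rewrite integral_cst// mul1e; exact: probability_setT.
have upper : (\int[@lebesgue_measure R]_(u in `[q a (eta theta0), +oo[) g (eta theta0) u =
    (1 - a)%:E)%E.
  have [nu nuE] := piE O0; rewrite -nuE//.
  have nu1 := density_atomless (mg O0) nuE.
  by rewrite (atomless_itvy nu1) nuE// -/(C _ _) Cq0 -EFinB.
move: sum1; rewrite h2 upper.
case: (\int[P theta0]_w _)%E => [r||]//=; rewrite -EFinD => -[h].
by congr EFin; lra.
Qed.

Lemma prediction_coverage (alpha : R) (PI : R -> set R) theta0 : 0 < alpha < 1 ->
  (forall t, Omega t -> [/\ PI t `<=` Omega_u, is_interval (PI t) &
    (\int[@lebesgue_measure R]_(u in PI t) g t u = (1 - alpha)%:E)%E]) ->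
  (forall t t', Omega t -> Omega t' ->
    (\int[@lebesgue_measure R]_(u in Omega_u `&` left_of (PI t)) g t u =
     \int[@lebesgue_measure R]_(u in Omega_u `&` left_of (PI t')) g t' u)%E) ->
  Theta theta0 -> measurable [set w | PI (Z w) (U w)] ->
  P theta0 [set w | PI (Z w) (U w)] = (1 - alpha)%:E.
Proof.
move=> /andP[a0 a1] hPI htail T0 mE; have O0 := Oeta T0.
have mOu : measurable Omega_u by exact: is_interval_measurable.
have mgO t : Omega t -> measurable_fun Omega_u (g t).
  by move=> Ot; apply: measurable_funTS; exact: mg.
pose p := (\int[@lebesgue_measure R]_(u in Omega_u `&` left_of (PI (eta theta0)))
        g (eta theta0) u)%E.
have hp t : Omega t ->
  (\int[@lebesgue_measure R]_(u in Omega_u `&` left_of (PI t)) g t u = p)%E.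
  by move=> Ot; exact: htail.
have [pr pE pr01] : exists2 r, p = r%:E & 0 <= r <= alpha.
  have [s i m] := hPI _ O0.
  have := interval_mass_le mOu (mgO _ O0) (fun u _ => g0 _ u) s i (hp _ O0) m.
  have gO1 : (\int[@lebesgue_measure R]_(u in Omega_u) g (eta theta0) u <= 1)%E.
    by rewrite -(g1 O0); apply: ge0_subset_integral => //; exact: mg.
  move=> /le_trans/(_ gO1) p1.
  have p0 : (0 <= p)%E by exact: integral_ge0.
  have pfin : p \is a fin_num.
    rewrite ge0_fin_numE//; apply: le_lt_trans (ltry 1); apply: le_trans p1.
    by rewrite leeDl// lee_fin; lra.
  exists (fine p); first by rewrite fineK.
  rewrite -(fineK pfin) in p0 p1.
  by move: p0 p1; rewrite -EFinD !lee_fin => -> /=; lra.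
pose D t x := (\int[@lebesgue_measure R]_(u in Omega_u `&` [set z | (z < x)%R]) g t u)%E.
have DC t x : Omega t -> D t x = C t x.
  move=> Ot; have [nu nuE] := piE Ot.
  have nu1 := density_atomless (mg Ot) nuE.
  have nuO := density_support iOu (g0 t) (fun u => gD u Ot) nuE.
  rewrite /C -nuE// -(atomless_itv nu1) /D -nuE; last first.
    by apply: measurableI => //; exact: open_measurable.
  apply: (measure_eq_outside_null (N := ~` Omega_u)) => //.
  - exact: measurableC.
  - by apply: measurableI => //; exact: open_measurable.
  - by move=> z /= /contrapT Oz; rewrite in_itv/=; split => [[]|].
have inC t x : Omega t -> PI t x -> (p <= C t x)%E /\ (C t x <= p + (1 - alpha)%:E)%E.
  move=> Ot; have [s i m] := hPI _ Ot; rewrite -(DC _ _ Ot).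
  exact: (interval_mass_in mOu (mgO _ Ot) (fun u _ => g0 _ u) s i (hp _ Ot) m).
have memC t x : Omega t -> (p < C t x)%E -> (C t x < p + (1 - alpha)%:E)%E -> PI t x.
  move=> Ot; have [s i m] := hPI _ Ot; rewrite -(DC _ _ Ot).
  exact: (interval_mass_mem mOu (mgO _ Ot) (fun u _ => g0 _ u) s i (hp _ Ot) m).
have [N [mN N0 NO]] := N_UZ T0.
pose V w := fine (C (Z w) (U w)).
have VE w : ~ N w -> C (Z w) (U w) = (V w)%:E.
  move=> /NO[OZ _]; rewrite /V fineK//; have /andP[c0' c1'] := C01 (U w) OZ.
  by rewrite ge0_fin_numE//; exact: le_lt_trans c1' (ltry 1).
have hF b : 0 < b < 1 -> exists G, [/\ measurable G, P theta0 G = b%:E &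
    forall w, ~ N w -> G w <-> V w <= b].
  move=> b01; have [G [mG PG GE]] := pivot T0 b01; exists G; split => // w Nw.
  by have [OZ OU] := NO _ Nw; apply: (iff_trans (GE _ OZ OU)); rewrite VE// lee_fin.
rewrite pE in inC memC.
have -> : 1 - alpha = (pr + (1 - alpha)) - pr by lra.
apply: (coverage_squeeze (V := V) mN N0 hF mE); [lra|lra|lra| |].
  move=> w Nw h; have [OZ _] := NO _ Nw.
  by apply: memC => //; rewrite VE// -?EFinD lte_fin; lra.
move=> w Nw; have [OZ _] := NO _ Nw => /(inC _ _ OZ).
by rewrite VE// -EFinD !lee_fin => -[-> ->].
Qed.

End prediction.

Lemma as_sample_space d (W : measurableType d) (R : realType) (n : nat)
    (P : probability W R) (X : 'I_n.+1 -> {mfun W >-> R}) (g : R -> R) (D : set R) :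
  is_interval D -> (forall i, has_density_on P (X i) g D) ->
  exists N, [/\ measurable N, P N = 0%E & forall w, ~ N w -> sample_space D (sample X w)].
Proof.
move=> iD dens; have mD : measurable D by exact: is_interval_measurable.
pose F i := X (widen_ord (leqnSn n) i) @^-1` (~` D).
have mF i : measurable (F i).
  by rewrite -[X in measurable X]setTI; apply: measurable_funPT => //; exact: measurableC.
have F0 i : P (F i) = 0%E.
  have [g0 gD ->] := dens (widen_ord (leqnSn n) i); last exact: measurableC.
  apply: integral0_eq => u /= Du; congr EFin; apply/eqP.
  by rewrite eq_le g0 andbT leNgt; apply/negP => /gD.
exists (\big[setU/set0]_(i < n) F i); split.
- exact: bigsetU_measurable.
- suff [] : measurable (\big[setU/set0]_(i < n) F i) /\
    P (\big[setU/set0]_(i < n) F i) = 0%E by [].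
  elim/big_ind: _ => [|A B [mA A0] [mB B0]|i _]; [by rewrite measure0| |by []].
  split; first exact: measurableU.
  apply/eqP; rewrite eq_le measure_ge0 andbT.
  apply: (@le_trans _ _ (P A + P B)%E); first exact: measureU2.
  by rewrite A0 B0 adde0.
- move=> w Nw i; rewrite /sample tnth_mktuple; apply: contrapT => h; apply: Nw.
  by rewrite (bigD1 i)//=; left.
Qed.

Lemma pred_densityE d (W : measurableType d) (R : realType) (n : nat) (Theta : set R)
    (P : R -> probability W R) (Z : {mfun W >-> R}) (T : n.-tuple R -> R)
    (f : R -> R -> R) (D : set R) (y : n.-tuple R) :
  (forall theta u, Theta theta -> 0 < f theta u <-> D u) -> sample_space D y ->
  pred_density Theta P Z T f y = pred_density_at Theta P Z f (T y).
Proof.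
move=> fD Dy; apply/funext => u; apply: eq_integral => theta /set_mem Tt.
congr EFin; rewrite /h_confidence /cond_density /ext_lik; congr (_ * _).
rewrite mulrAC divff ?mul1r// gt_eqF//.
by apply: prodr_gt0 => i _; apply/(fD _ _ Tt).
Qed.

Unset Implicit Arguments.
Theorem theorem4 (R : realType) (d : measure_display) (W : measurableType d)
  (* the model: parameter space, P_theta, Y_1, ..., Y_n and U = Y_(n+1) *)
  (Theta : set R) (P : R -> probability W R) (n : nat) (hn : (0 < n)%N)
  (X : 'I_n.+1 -> {mfun W >-> R}) (f : R -> R -> R) (Omega_u : set R)
  (hTheta : open Theta)
  (hOmega_u : is_interval Omega_u)
  (hindep : forall theta : R, Theta theta -> mutually_independent (P theta) X)
  (hdens : forall (theta : R) (i : 'I_n.+1), Theta theta ->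
     has_density_on (P theta) (X i) (f theta) Omega_u)
  (hfmeas : measurable_fun (Theta `*` [set: R]) (fun p : R * R => f p.1 p.2))
  (* the sufficient statistic T of the sample and the sufficient statistic T1 of
     the single observation U *)
  (T : {mfun n.-tuple R >-> R}) (T1 : {mfun R >-> R}) (Omega : set R)
  (hTrange : T @` sample_space Omega_u = Omega)
  (hTsuff : sufficient Theta P (sample X) T)
  (hT1range : T1 @` Omega_u `<=` Omega)
  (hT1inj : set_inj Omega_u T1) (hT1mono : monotone_on Omega_u T1)
  (hT1suff : sufficient Theta P (X ord_max) T1)
  (* the transformation eta and F_n(t; eta) = F_n(eta; t) *)
  (eta : R -> R) (heta_bij : set_bij Theta Omega eta)
  (heta_mono : monotone_on Theta eta)
  (hFn : forall t h : R, Omega t -> Omega h ->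
     cdf_eta Theta P eta (T \o sample X) t h =
     cdf_eta Theta P eta (T \o sample X) h t)
  (* the confidence density c(theta; y) *)
  (hderiv : forall t theta : R, Omega t -> Theta theta ->
     derivable (tail_prob P (T \o sample X) t) theta 1)
  (hconf : forall t : R, Omega t ->
     (\int[@lebesgue_measure R]_(theta in Theta)
        (conf_density P (T \o sample X) t theta)%:E = 1)%E)
  (* the observed intervals *)
  (alpha : R) (halpha : 0 < alpha < 1)
  (CI PI : R -> set R)
  (hCI : forall t : R, Omega t ->
     [/\ CI t `<=` Theta, is_interval (CI t)
       & (\int[@lebesgue_measure R]_(theta in CI t)
            (conf_density P (T \o sample X) t theta)%:E = (1 - alpha)%:E)%E])
  (hPI : forall y : n.-tuple R, sample_space Omega_u y ->
     [/\ PI (T y) `<=` Omega_u, is_interval (PI (T y))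
       & (\int[@lebesgue_measure R]_(u in PI (T y))
            pred_density Theta P (T \o sample X) T f y u
          = (1 - alpha)%:E)%E])
  (* the mass alpha left out is split between the two tails in the same way for
     all observed data *)
  (hCItail : forall t t' : R, Omega t -> Omega t' ->
     (\int[@lebesgue_measure R]_(theta in Theta `&` left_of (CI t))
        (conf_density P (T \o sample X) t theta)%:E =
      \int[@lebesgue_measure R]_(theta in Theta `&` left_of (CI t'))
        (conf_density P (T \o sample X) t' theta)%:E)%E)
  (hPItail : forall y y' : n.-tuple R,
     sample_space Omega_u y -> sample_space Omega_u y' ->
     (\int[@lebesgue_measure R]_(u in Omega_u `&` left_of (PI (T y)))
        pred_density Theta P (T \o sample X) T f y u =
      \int[@lebesgue_measure R]_(u in Omega_u `&` left_of (PI (T y')))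
        pred_density Theta P (T \o sample X) T f y' u)%E)
  (* the coverage events are events *)
  (hCImeas : forall theta : R, Theta theta ->
     measurable [set w | CI (T (sample X w)) theta])
  (hPImeas : measurable [set w | PI (T (sample X w)) (X ord_max w)])
  (* q a t is the a-quantile of c(u; t) *)
  (q : R -> R -> R)
  (hq : forall (a : R) (y : n.-tuple R), 0 < a < 1 -> sample_space Omega_u y ->
     q a (T y) = quantile (pred_density Theta P (T \o sample X) T f y) a)
  (hF1 : forall a t h : R, 0 < a < 1 -> Omega t -> Omega h ->
     cdf_eta Theta P eta (T1 \o X ord_max) (T1 (q a t)) h =
     cdf_eta Theta P eta (T1 \o X ord_max) t (T1 (q a h))) :
  forall theta0 : R, Theta theta0 ->
    P theta0 [set w | CI (T (sample X w)) theta0] = (1 - alpha)%:E /\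
    P theta0 [set w | PI (T (sample X w)) (X ord_max w)] = (1 - alpha)%:E.
Proof.
move=> theta0 T0.
pose Z : {mfun W >-> R} := T \o sample X.
have fD theta u : Theta theta -> 0 < f theta u <-> Omega_u u.
  by move=> Tt; case: (hdens theta ord_max Tt).
have TO y : sample_space Omega_u y -> Omega (T y) by rewrite -hTrange; exists y.
have OT t : Omega t -> exists2 y, sample_space Omega_u y & T y = t.
  by rewrite -hTrange.
have ZOmega theta : Theta theta ->
    exists N, [/\ measurable N, P theta N = 0%E & forall w, ~ N w -> Omega (Z w)].
  move=> Tt; have [N [mN N0 NS]] := as_sample_space hOmega_u (fun i => hdens theta i Tt).
  by exists N; split => // w /NS; exact: TO.
split.
  exact: (confidence_coverage hTheta heta_bij heta_mono ZOmega hFn hderiv hconf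
    halpha hCI hCItail T0 (hCImeas _ T0)).
have indep theta A B : Theta theta -> measurable A -> measurable B ->
    (P theta (Z @^-1` A `&` X ord_max @^-1` B) =
     P theta (Z @^-1` A) * P theta (X ord_max @^-1` B))%E.
  move=> Tt mA mB; have mTA : measurable (T @^-1` A).
    by rewrite -[X in measurable X]setTI; exact: measurable_funPT.
  exact: (independent_sample (hindep theta Tt) mTA mB).
have predE y : sample_space Omega_u y ->
    pred_density Theta P (T \o sample X) T f y = pred_density_at Theta P Z f (T y).
  by move=> Sy; exact: pred_densityE fD Sy.
apply: (prediction_coverage hTheta heta_bij heta_mono ZOmega hFn hderiv hconf
  hOmega_u (fun theta => hdens theta ord_max) hfmeas indep hT1range hT1inj hT1mono
  (q := q) _ hF1 halpha _ _ T0 hPImeas).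
- by move=> a t a01 /OT[y Sy <-]; rewrite (hq a y a01 Sy) (predE y Sy).
- by move=> t /OT[y Sy <-]; rewrite -(predE y Sy); exact: (hPI y Sy).
- move=> t t' /OT[y Sy <-] /OT[y' Sy' <-].
  by rewrite -(predE y Sy) -(predE y' Sy'); exact: (hPItail y y' Sy Sy').
Qed.
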